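(* For every $u\equiv 2,4\pmod 6$ and every positive integer $n$, there exists a 2-D $(u\times 2^n,4,2)$-OOC with exactly $J^*(u\times 2^n)$ codewords.
   Context: A 2-D $(u\times v,4,2)$-OOC is a family $\mathcal C$ of $u\times v$ $(0,1)$-matrices of Hamming weight $4$ such that for all $A=(a_{ij}),B=(b_{ij})\in\mathcal C$ and integers $r$ with $A\ne B$ or $r\not\equiv0\pmod v$, $\sum_{i,j}a_{ij}b_{i,j+r}\le 2$ (column indices mod $v$). Write $N=\lfloor\frac{uv-1}{3}\lfloor\frac{uv-2}{2}\rfloor\rfloor$. Let $A=\{(u,v):u\equiv0\ (\mathrm{mod}\ 12),\ v\equiv2,4\ (\mathrm{mod}\ 6)\}$ and $B=\{(u,v):uv\equiv0\ (\mathrm{mod}\ 12),\ v\equiv0\ (\mathrm{mod}\ 6)\}$. Define $J^*(u\times v)$ as: $\lfloor\frac{u}{4}N\rfloor-1$ if $u\equiv7,11\pmod{12}$ and $v=2$; $\lfloor\frac{u}{4}(N-1)\rfloor$ if either ($uv\equiv0\pmod 6$ and $(u,v)\notin A\cup B$) or ($uv\equiv4,8\pmod{12}$ and $v$ even); $\lfloor\frac{u}{4}(N-1)\rfloor-1$ if $(u,v)\in A$; $\lfloor\frac{u}{4}(N-2)\rfloor$ if $(u,v)\in B$; and $\lfloor\frac{u}{4}N\rfloor$ otherwise. *)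

(* Defs.v *)
From mathcomp Require Import all_boot all_order all_algebra.
Set Implicit Arguments. Unset Strict Implicit. Unset Printing Implicit Defensive.

Definition ord_shift (v : nat) (j : 'I_v) (r : nat) : 'I_v :=
  Ordinal (ltn_pmod (j + r) (leq_ltn_trans (leq0n j) (ltn_ord j))).

Definition hweight (u v : nat) (A : 'M[bool]_(u, v)) : nat :=
  \sum_(i < u) \sum_(j < v) nat_of_bool (A i j).

Definition corr (u v : nat) (A B : 'M[bool]_(u, v)) (r : nat) : nat :=
  \sum_(i < u) \sum_(j < v) nat_of_bool (A i j && B i (ord_shift j r)).

(* 2-D (u x v, w, lam)-OOC.  Shifts r range over nat, which covers all
   residues mod v (the condition only depends on r mod v). *)
Definition is_OOC2D (u v w lam : nat) (C : {set 'M[bool]_(u, v)}) : Prop :=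
  (forall A, A \in C -> hweight A = w) /\
  (forall A B (r : nat), A \in C -> B \in C ->
      (A != B \/ r %% v != 0) -> corr A B r <= lam).

Definition Nval (u v : nat) : nat :=
  ((u * v - 1) * ((u * v - 2) %/ 2)) %/ 3.

Definition inA (u v : nat) : bool :=
  (u %% 12 == 0) && ((v %% 6 == 2) || (v %% 6 == 4)).

Definition inB (u v : nat) : bool :=
  ((u * v) %% 12 == 0) && (v %% 6 == 0).

(* J*(u x v); floor(u/4 * x) = (u * x) %/ 4. *)
Definition Jstar (u v : nat) : nat :=
  let N := Nval u v in
  if ((u %% 12 == 7) || (u %% 12 == 11)) && (v == 2) then (u * N) %/ 4 - 1
  else if (((u * v) %% 6 == 0) && ~~ (inA u v || inB u v))
          || ((((u * v) %% 12 == 4) || ((u * v) %% 12 == 8)) && ~~ odd v)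
    then (u * (N - 1)) %/ 4
  else if inA u v then (u * (N - 1)) %/ 4 - 1
  else if inB u v then (u * (N - 2)) %/ 4
  else (u * N) %/ 4.

(* Main.v *)
Require Import Defs.
From HB Require Import structures.
From mathcomp Require Import all_boot all_order all_algebra.
From mathcomp Require Import zify ring.
Set Implicit Arguments. Unset Strict Implicit. Unset Printing Implicit Defensive.
Import GRing.Theory.

(** A Steiner quadruple system on X is the same thing as a symmetric operation
    q : X^3 -> X with q x x y = y and q x y (q x y z) = z, the blocks being the
    sets {x, y, z, q x y z}.

    If u = 2, 4 (mod 6) there is such an operation on u points.  It is doubled
    n times: a point x of the old system becomes the points 2x and 2x + 1 of
    the new one, both halves carry a copy of the old system, and the blocks
    with two points in each half come from matchings chosen so that the shift
    x -> x + 1 remains an automorphism.  The result is an operation on u copies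
    of Z/2^n for which each pair {x, x + 2^(n-1)} lies in a single block fixed
    by the shift by 2^(n-1).  All other blocks have full orbits.  Two blocks
    with three common points are equal, so one block from each full orbit gives
    a code, and counting triples shows that it has at least J* words.

    Steiner quadruple systems of all orders 2, 4 (mod 6) are obtained by
    induction, as in Hanani's theorem: f -> 2f, 4f - 6, 3f - 2, 12f - 10,
    3f - 4 and 3f - 8, all but the first by filling the groups of a
    candelabra system. *)

(** * Steiner operations and one-factorizations *)

(** The size of the code depends on how few blocks have short orbits. In a cyclic group of order
    2^(n+1) every nontrivial subgroup contains the involution h, so a block with a short orbit is a
    union of two pairs {x, x + h}. With w points in all, at most 6w of the w(w-1)(w-2) ordered
    triples are lost to such blocks, and this is what J* allows for by taking N - 1 in place of N.
    Short blocks threaten at the first doubling: with the same colours on both halves, {x, x + h, z,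
    z + h} would be a block for all x and z. Negating the colours, which lie in a group of odd
    order, leaves at most one such z besides x among the u points. In later doublings h stays within
    a half, so it suffices that no cross matching of a pair {x, x + h} joins z to z + h. In a
    candelabra system with three groups of order g and a stem of size s, the g - s sums outside the
    stem are matched in pairs and the pairs are shared by three centres. This is uniform if 6
    divides g - s; g = 12 with s = 2 leaves five pairs and needs its own construction. *)

Record steiner_op (X : Type) (q : X -> X -> X -> X) : Prop := SteinerOp {
  st12 : forall x y z, q x y z = q y x z;
  st23 : forall x y z, q x y z = q x z y;
  stxx : forall x y, q x x y = y;
  stK : forall x y z, q x y (q x y z) = z }.

(** A one-factorization of the complete graph on X, [par c x] being the neighbour of x along the
    colour c. The loops get a colour [c0] of their own, whose matching is the identity, so that
    [col] and [par] are total. *)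
Record factoring (X C : Type) (col : X -> X -> C) (par : C -> X -> X)
    (c0 : C) : Prop := Factoring {
  colC : forall x y, col x y = col y x;
  colxx : forall x, col x x = c0;
  parE : forall x y, par (col x y) x = y;
  colE : forall c x, col x (par c x) = c }.

Lemma card_bijection (X Y : finType) : #|X| = #|Y| ->
  exists f : X -> Y, exists2 g : Y -> X, cancel f g & cancel g f.
Proof.
move=> eXY; exists (fun x => enum_val (cast_ord eXY (enum_rank x))).
exists (fun y => enum_val (cast_ord (esym eXY) (enum_rank y))) => x;
  by rewrite enum_valK ?cast_ordK ?cast_ordKV enum_rankK.
Qed.

Section CyclicFactoring.
Variable j : nat.
Local Notation Z := 'I_(j.*2.+1).
Local Open Scope ring_scope.

Let halfz (c : Z) : Z := c *+ j.+1.

Let halfzK c : halfz c + halfz c = c.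
Proof.
rewrite /halfz -mulrnDr addSn addnS addnn mulrS -[RHS]addr0; congr (_ + _).
apply: val_inj; rewrite /= Zp_mulrn /=.
by rewrite modnMl.
Qed.

Let addzz_inj : injective (fun a : Z => a + a).
Proof.
move=> a b /= eab; have: halfz (a + a) = halfz (b + b) by rewrite eab.
by rewrite /halfz !mulrnDl -/(halfz a) -/(halfz b) !halfzK.
Qed.

(** The round-robin tournament on Z/(2j+1) and a point at infinity [None]: in round c infinity meets
    c/2, and j + 1 is the inverse of 2. *)
Definition cyc_col (x y : option Z) : option Z :=
  if x == y then None else
  match x, y with
  | Some a, Some b => Some (a + b)
  | None, Some a | Some a, None => Some (a + a)
  | None, None => None
  end.

Definition cyc_par (c x : option Z) : option Z :=
  match c, x with
  | None, _ => x
  | Some c, None => Some (halfz c)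
  | Some c, Some a => if a + a == c then None else Some (c - a)
  end.

Lemma cyc_factoring : factoring cyc_col cyc_par None.
Proof.
split=> [x y|x|x y|c x]; rewrite /cyc_col.
- rewrite eq_sym; case: eqP => // _.
  by case: x y => [a|] [b|] //; rewrite addrC.
- by rewrite eqxx.
- case: eqP => [->//|]; case: x y => [a|] [b|] //= nab; last first.
  + by congr Some; apply: addzz_inj; rewrite halfzK.
  + by rewrite eqxx.
  case: eqP => [/addrI eab|_]; first by case: nab; rewrite eab.
  by rewrite addrAC subrr add0r.
- case: c x => [c|] [a|] /=; rewrite ?eqxx //; last by rewrite halfzK.
  case: (a + a =P c) => [<- //|nac] /=.
  case: eqP => [[eac]|_]; first by case: nac; rewrite {2}eac addrC subrK.
  by rewrite addrC subrK.
Qed.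

(** The recolouring between the halves in the first doubling. Only the colours it fixes lead to
    short blocks, and as the group has odd order these are the loop colour and 0. *)
Definition oppo (c : option Z) : option Z := omap (fun c => - c) c.

Lemma oppoK : involutive oppo.
Proof. by case=> //= c; rewrite opprK. Qed.

Lemma oppo_fix c : oppo c = c -> c = None \/ c = Some 0.
Proof.
case: c => [c|] /=; [move=> [ec]; right|by left].
by congr Some; apply: addzz_inj; rewrite addr0 -{1}ec addNr.
Qed.

(** Trades the identity matching for a proper one, so that a pair of points in the same group is
    matched without fixed groups; see [mate_neq]. *)
Definition swap0 (c : option Z) : option Z :=
  if c == None then Some 0 else if c == Some 0 then None else c.

Lemma swap0K : involutive swap0.
Proof.
move=> c; rewrite /swap0.
by case: (eqVneq c None) => [->|nc] //; case: (eqVneq c (Some 0)) => [->|nc0] //;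
  rewrite (negPf nc) (negPf nc0).
Qed.

End CyclicFactoring.

Lemma factoring_exists (X : finType) j : #|X| = j.*2.+2 ->
  exists col : X -> X -> option 'I_(j.*2.+1),
  exists par, factoring col par None.
Proof.
move=> cX; have [|f [g fK gK]] := @card_bijection X (option 'I_(j.*2.+1)).
  by rewrite card_option card_ord.
have [cC cxx pE cE] := cyc_factoring j.
exists (fun x y => cyc_col (f x) (f y)).
exists (fun c x => g (cyc_par c (f x))); split=> [x y|x|x y|c x].
- exact: cC.
- exact: cxx.
- by rewrite pE fK.
- by rewrite gK cE.
Qed.

(* The extension of [G] by Z/2 in which twice the generator [(0, true)] is
   [e]: it sends Z/2^n with generator 1 to Z/2^(n+1) with generator 1. *)
Definition twist (G : finZmodType) (e : G) : Type := (G * bool)%type.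

Section Twist.
Variables (G : finZmodType) (e : G).
Local Notation twist := (twist e).
Local Open Scope ring_scope.

HB.instance Definition _ := Finite.copy twist (G * bool)%type.

Definition twist_add (x y : twist) : twist :=
  (x.1 + y.1 + (if x.2 && y.2 then e else 0), x.2 (+) y.2).
Definition twist_opp (x : twist) : twist :=
  (- x.1 - (if x.2 then e else 0), x.2).

Fact twist_addA : associative twist_add.
Proof.
move=> [a p] [b r] [c s]; rewrite /twist_add /= addbA; congr pair.
rewrite -!addrA; do 2!congr (_ + _).
by case: p r s => [] [] [] /=; rewrite ?addr0 ?add0r // addrC.
Qed.
Fact twist_addC : commutative twist_add.
Proof.
by move=> [a p] [b r]; rewrite /twist_add /= addbC andbC [a + b]addrC.
Qed.
Fact twist_add0 : left_id (0, false) twist_add.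
Proof. by move=> [a p]; rewrite /twist_add /= add0r addr0. Qed.
Fact twist_addN : left_inverse (0, false) twist_opp twist_add.
Proof.
move=> [a p]; rewrite /twist_add /= addbb andbb; congr pair.
by rewrite [_ - _ + a]addrAC addNr add0r addNr.
Qed.
HB.instance Definition _ :=
  GRing.isZmodule.Build twist twist_addA twist_addC twist_add0 twist_addN.

Definition tw1 : twist := (0, true).

Lemma tw1D (a : G) p : ((a, p) : twist) + tw1 = (if p then a + e else a, ~~ p).
Proof.
by rewrite -[LHS]/(twist_add _ _) /twist_add /= addr0 andbT; case: p; rewrite ?addr0.
Qed.

Lemma tw0D (a b : G) p : ((a, p) : twist) + ((b, false) : twist) = (a + b, p).
Proof. by rewrite -[LHS]/(twist_add _ _) /twist_add /= andbF addr0 addbF. Qed.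

Lemma tw1_muln j : tw1 *+ j = (e *+ j./2, odd j).
Proof.
elim: j => // j IHj; rewrite mulrSr IHj tw1D /= uphalf_half.
by case: (odd j) => //=; rewrite -mulrSr.
Qed.

End Twist.

(** * Doubling a system together with its cyclic automorphism *)

(* [rho x y] is the matching on a second copy of the points that completes
   the pair {x, y} of the first copy to blocks; [rhoD] says that the blocks
   remain blocks when the copies are exchanged, the second copy being
   carried to the first one by [T]. *)
Record cross_op (X : Type) (T : X -> X) (rho : X -> X -> X -> X) : Prop :=
  CrossOp {
  rhoC : forall x y z, rho x y z = rho y x z;
  rhoxx : forall x z, rho x x z = z;
  rhoK : forall x y z, rho x y (rho x y z) = z;
  rhoT : forall x y z, rho (T x) (T y) (T z) = T (rho x y z);
  rhoD : forall x y z, rho (T z) (T (rho x y z)) x = y }.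

Section Doubling.
Variables (u j : nat).
Let Col := option 'I_(j.*2.+1).
Variables (col : 'I_u -> 'I_u -> Col) (par : Col -> 'I_u -> 'I_u).
Hypothesis fac : factoring col par None.
Variables (G : finZmodType) (e : G).
Let X := ('I_u * G)%type.
Let X2 := ('I_u * twist e)%type.
Local Open Scope ring_scope.

Definition shift (x : X) : X := (x.1, x.2 + e).
Definition shift2 (x : X2) : X2 := (x.1, x.2 + tw1 e).
Definition inj2 (x : X) (p : bool) : X2 := (x.1, (x.2, p)).

Lemma shift_inj : injective shift.
Proof. by move=> [i a] [k b] [-> /addIr ->]. Qed.

Lemma shift2E x p : shift2 (inj2 x p) = inj2 (if p then shift x else x) (~~ p).
Proof. by case: x => i a; rewrite /shift2 /inj2 /= tw1D; case: p. Qed.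

Lemma inj2P (x : X2) : exists y, exists p, x = inj2 y p.
Proof. by case: x => i [a p]; exists (i, a), p. Qed.

Lemma inj2I x y p r : inj2 x p = inj2 y r -> x = y /\ p = r.
Proof. by case: x y => [i a] [k b] [-> -> ->]. Qed.

(** A rule for the sign in [odd_cross]. It must not change when both pairs are reversed, which is
    what the shift does, and must change when the two pairs trade places, as [rhoD] requires.
    Comparing the orders of the pairs achieves this; the ties are broken consistently unless i = i'
    and k = k', a case that [mate_neq] excludes. *)
Definition same_sign (i i' k k' : 'I_u) : bool :=
  if i == i' then true else if k == k' then false else (i < i')%N == (k < k')%N.

Lemma same_signC i i' k k' : same_sign i' i k' k = same_sign i i' k k'.
Proof.
rewrite /same_sign eq_sym; case: (ltngtP i i') => [lt|gt|/val_inj->];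
  rewrite ?eqxx //; [rewrite -val_eqE ltn_eqF // | rewrite -val_eqE gtn_eqF //];
  rewrite eq_sym -[k == k']val_eqE; by case: ltngtP.
Qed.

Lemma same_sign_flip i i' k k' : (i, k) != (i', k') ->
  same_sign k' k i i' = ~~ same_sign i i' k k'.
Proof.
rewrite /same_sign xpair_eqE [k' == k]eq_sym -!val_eqE /=.
by case: (ltngtP i i') => //=; case: (ltngtP k k').
Qed.

Definition mate (i i' k : 'I_u) : 'I_u := par (swap0 (col i i')) k.

Lemma mateK i i' k : mate i' i (mate i i' k) = k.
Proof.
have [cC cxx pE cE] := fac; rewrite /mate (cC i').
by set g := swap0 _; have := pE (par g k) k; rewrite cC cE.
Qed.

Lemma mateD i i' k : mate (mate i i' k) k i = i'.
Proof.
have [cC cxx pE cE] := fac.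
by rewrite {1}/mate [col (mate _ _ _) _]cC cE swap0K pE.
Qed.

Lemma mate_neq i i' k : (i, k) != (i', mate i i' k).
Proof.
have [cC cxx pE cE] := fac; apply/eqP=> [[<-]].
rewrite /mate cxx /swap0 eqxx => ek.
by have := cE (Some 0) k; rewrite -ek cxx.
Qed.

(** Read (a, p) as 2a + p in the larger cyclic group, where 2 is [e]. With d = y - x for x in the
    even and y in the odd half, z goes to z + d or z - d according to the sign; the term - e comes
    from the carry in z - d. Only differences enter, hence the invariance under the shift. *)
Definition odd_cross (x y z : X) : X :=
  let k' := mate x.1 y.1 z.1 in
  (k', if same_sign x.1 y.1 z.1 k' then z.2 + (y.2 - x.2)
       else z.2 - (y.2 - x.2) - e).

Definition odd_cross_inv (x y z : X) : X :=
  let k' := mate x.1 y.1 z.1 in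
  (k', if same_sign x.1 y.1 k' z.1 then z.2 - (y.2 - x.2)
       else z.2 + (y.2 - x.2) + e).

Lemma mateC i i' k : mate i i' k = mate i' i k.
Proof. by have [cC _ _ _] := fac; rewrite /mate cC. Qed.

Lemma odd_crossK x y z : odd_cross_inv x y (odd_cross x y z) = z.
Proof.
case: x y z => [i a] [i' b] [k c]; rewrite /odd_cross_inv /odd_cross /=.
rewrite [mate i i' (mate _ _ _)]mateC mateK.
by case: same_sign; rewrite ?subrK ?addrK // -addrA [_ + e]addrC addrA !subrK.
Qed.

Lemma odd_cross_invK x y z : odd_cross x y (odd_cross_inv x y z) = z.
Proof.
case: x y z => [i a] [i' b] [k c]; rewrite /odd_cross_inv /odd_cross /=.
rewrite [mate i i' (mate _ _ _)]mateC mateK.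
by case: same_sign; rewrite ?subrK // [_ - (b - a)]addrAC addrK addrK.
Qed.

Lemma odd_crossT x y z : odd_cross (shift y) x (shift (odd_cross x y z)) = z.
Proof.
case: x y z => [i a] [i' b] [k c]; rewrite /odd_cross /shift /=.
rewrite mateK same_signC -[a - _]opprB [b + e - a]addrAC.
case: same_sign; first by rewrite -[_ + _ + e]addrA addrK.
by rewrite subrK opprK addrA subrK addrK.
Qed.

Lemma odd_crossD x y z : odd_cross (shift (odd_cross x y z)) z x = y.
Proof.
case: x y z => [i a] [i' b] [k c]; rewrite /odd_cross /shift /=.
rewrite mateD same_sign_flip ?mate_neq //; case: same_sign => /=; congr pair.
  rewrite opprB [c + _ + e]addrAC [c + e + _]addrAC [c + _ + e - c]addrAC.
  by rewrite [c + _ - c]addrAC subrr add0r addrA addrK addrC subrK.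
by rewrite subrK opprB [b - a - c]addrC addNKr addrC subrK.
Qed.

Variables q rho : X -> X -> X -> X.
Hypotheses (qS : steiner_op q) (rS : cross_op shift rho).
Hypothesis qT : forall x y z, q (shift x) (shift y) (shift z) = shift (q x y z).

Let hd (x : X2) : X := (x.1, x.2.1).
Let bt (x : X2) : bool := x.2.2.

Definition dbl_op (x y z : X2) : X2 :=
  let x' := hd x in let y' := hd y in let z' := hd z in
  match bt x, bt y, bt z with
  | false, false, false => inj2 (q x' y' z') false
  | true, true, true => inj2 (q x' y' z') true
  | false, false, true => inj2 (rho x' y' z') true
  | false, true, false => inj2 (rho x' z' y') true
  | true, false, false => inj2 (rho y' z' x') true
  | true, true, false => inj2 (rho (shift x') (shift y') z') false
  | true, false, true => inj2 (rho (shift x') (shift z') y') false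
  | false, true, true => inj2 (rho (shift y') (shift z') x') false
  end.

(** Pairs with an even difference reuse [rho] and keep z in its half; pairs with an odd difference
    get the new matchings, which exchange the halves. *)
Definition dbl_cross (x y z : X2) : X2 :=
  let x' := hd x in let y' := hd y in let z' := hd z in
  match bt x, bt y, bt z with
  | false, false, s => inj2 (rho x' y' z') s
  | true, true, true => inj2 (rho x' y' z') true
  | true, true, false => inj2 (rho (shift x') (shift y') z') false
  | false, true, false => inj2 (odd_cross x' y' z') true
  | false, true, true => inj2 (odd_cross_inv x' y' z') false
  | true, false, false => inj2 (odd_cross y' x' z') true
  | true, false, true => inj2 (odd_cross_inv y' x' z') false
  end.

Lemma hd_inj2 x p : hd (inj2 x p) = x. Proof. by case: x. Qed.
Lemma bt_inj2 x p : bt (inj2 x p) = p. Proof. by []. Qed.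

Lemma dbl_steiner : steiner_op dbl_op.
Proof.
have [q12 q23 qxx qK] := qS; have [rC rxx rK rT rD] := rS.
have rD' x y z : rho z (rho (shift x) (shift y) z) x = y.
  by apply: shift_inj; rewrite -rT rD.
split.
- move=> x y z; have [x' [p ->]] := inj2P x; have [y' [r ->]] := inj2P y.
  have [z' [s ->]] := inj2P z; rewrite /dbl_op !hd_inj2 !bt_inj2.
  by case: p; case: r; case: s; rewrite 1?q12 1?rC.
- move=> x y z; have [x' [p ->]] := inj2P x; have [y' [r ->]] := inj2P y.
  have [z' [s ->]] := inj2P z; rewrite /dbl_op !hd_inj2 !bt_inj2.
  by case: p; case: r; case: s; rewrite 1?q23 1?rC.
- move=> x y; have [x' [p ->]] := inj2P x; have [y' [r ->]] := inj2P y.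
  rewrite /dbl_op !hd_inj2 !bt_inj2.
  by case: p; case: r; rewrite ?qxx ?rxx.
move=> x y z; have [x' [p ->]] := inj2P x; have [y' [r ->]] := inj2P y.
have [z' [s ->]] := inj2P z; rewrite /dbl_op !hd_inj2 !bt_inj2.
case: p; case: r; case: s; rewrite !hd_inj2 !bt_inj2 ?qK ?rK ?rD ?rD' //.
Qed.

Let odd_cross_invP x y z w : odd_cross x y z = w -> odd_cross_inv x y w = z.
Proof. by move <-; apply: odd_crossK. Qed.

Lemma dbl_crossP : cross_op shift2 dbl_cross.
Proof.
have [rC rxx rK rT rD] := rS.
have rD' x y z : rho z (rho (shift x) (shift y) z) x = y.
  by apply: shift_inj; rewrite -rT rD.
split.
- move=> x y z; have [x' [p ->]] := inj2P x; have [y' [r ->]] := inj2P y.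
  have [z' [s ->]] := inj2P z; rewrite /dbl_cross !hd_inj2 !bt_inj2.
  by case: p; case: r; case: s; rewrite 1?rC.
- move=> x z; have [x' [p ->]] := inj2P x; have [z' [s ->]] := inj2P z.
  rewrite /dbl_cross !hd_inj2 !bt_inj2.
  by case: p; case: s; rewrite ?rxx.
- move=> x y z; have [x' [p ->]] := inj2P x; have [y' [r ->]] := inj2P y.
  have [z' [s ->]] := inj2P z; rewrite /dbl_cross !hd_inj2 !bt_inj2.
  by case: p; case: r; case: s;
     rewrite !hd_inj2 !bt_inj2 ?rK ?odd_crossK ?odd_cross_invK.
- move=> x y z; have [x' [p ->]] := inj2P x; have [y' [r ->]] := inj2P y.
  have [z' [s ->]] := inj2P z.
  rewrite !shift2E /dbl_cross !hd_inj2 !bt_inj2.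
  case: p; case: r; case: s => /=; rewrite ?shift2E ?rT //; congr inj2;
    try (by apply: odd_cross_invP; rewrite odd_crossT).
  + by rewrite -[in LHS](odd_cross_invK y' x' z') odd_crossT.
  + by rewrite -[in LHS](odd_cross_invK x' y' z') odd_crossT.
move=> x y z; have [x' [p ->]] := inj2P x; have [y' [r ->]] := inj2P y.
have [z' [s ->]] := inj2P z.
rewrite shift2E /dbl_cross !hd_inj2 !bt_inj2.
case: p; case: r; case: s => /=; rewrite ?shift2E ?hd_inj2 ?bt_inj2 /=;
  rewrite ?hd_inj2 ?bt_inj2 ?rD ?rD' ?odd_crossD //; congr inj2.
- apply: odd_cross_invP; rewrite -[in LHS](odd_cross_invK y' x' z').
  by rewrite odd_crossK odd_crossD.
- by apply: odd_cross_invP; rewrite odd_crossD.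
- rewrite -{1}(odd_cross_invK x' y' z').
  by rewrite odd_crossD.
Qed.

Lemma dbl_opT x y z :
  dbl_op (shift2 x) (shift2 y) (shift2 z) = shift2 (dbl_op x y z).
Proof.
have [rC rxx rK rT rD] := rS.
have [x' [p ->]] := inj2P x; have [y' [r ->]] := inj2P y.
have [z' [s ->]] := inj2P z; rewrite !shift2E /dbl_op !hd_inj2 !bt_inj2.
by case: p; case: r; case: s => /=; rewrite shift2E ?qT ?rT.
Qed.

Definition anti (h : G) (x : X) : X := (x.1, x.2 + h).
Definition anti2 (h : twist e) (x : X2) : X2 := (x.1, x.2 + h).

Lemma anti2E h x p : anti2 (h, false) (inj2 x p) = inj2 (anti h x) p.
Proof. by case: x => i a; rewrite /anti2 /inj2 /= tw0D. Qed.

(** After the first doubling the involution is the generator itself, so x and its translate have an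
    odd difference and equal first coordinates, and [mate] moves every group. *)
Lemma dbl_cross_shift_neq x z : dbl_cross x (shift2 x) z <> shift2 z.
Proof.
have [x' [p ->]] := inj2P x; have [z' [s ->]] := inj2P z.
rewrite !shift2E /dbl_cross !hd_inj2 !bt_inj2.
have neq k : mate x'.1 x'.1 k != k.
  by have := mate_neq x'.1 x'.1 k; rewrite xpair_eqE eqxx /= eq_sym.
by case: p; case: s => /= eq1; have /eqP := neq z'.1; apply;
   have := congr1 fst eq1.
Qed.

Variable h : G.
Hypothesis rho_anti : forall x z, rho x (anti h x) z <> anti h z.
Hypothesis q_anti : forall x, (#|[set z | q x (anti h x) z == anti h z]| <= 4)%N.

Lemma shift_anti x : shift (anti h x) = anti h (shift x).
Proof. by rewrite /shift /anti /= addrAC. Qed.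

Lemma dbl_cross_anti x z :
  dbl_cross x (anti2 (h, false) x) z <> anti2 (h, false) z.
Proof.
have [x' [p ->]] := inj2P x; have [z' [s ->]] := inj2P z.
rewrite !anti2E /dbl_cross !hd_inj2 !bt_inj2.
by case: p; case: s; rewrite ?shift_anti => /inj2I[/rho_anti].
Qed.

(** The new involution keeps each half in place. A block {x, x + h, z, z + h} with two points in
    each half is ruled out by [rho_anti], so all of them lie in the half of x, where the old bound
    applies. *)
Lemma dbl_op_anti x :
  (#|[set z | dbl_op x (anti2 (h, false) x) z == anti2 (h, false) z]| <= 4)%N.
Proof.
have [x' [p ->]] := inj2P x; apply: leq_trans (q_anti x').
apply: leq_trans (leq_imset_card (inj2^~ p) _); apply/subset_leq_card/subsetP=> z.
have [z' [s ->]] := inj2P z; rewrite inE !anti2E /dbl_op !hd_inj2 !bt_inj2.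
case: p; case: s; rewrite ?shift_anti => /eqP/inj2I[];
  by [move=> + _ => /rho_anti | move=> /eqP qz _; apply/imset_f; rewrite inE].
Qed.

End Doubling.

(* The points are [u] copies of the cyclic group of order 2^(n+1) generated by
   [e], whose element of order two is [h]; the last condition bounds the blocks
   {x, x + h, z, z + h}, whose orbits are short. *)
Definition cyclic_steiner (u n : nat) (G : finZmodType) (e h : G)
    (q : 'I_u * G -> 'I_u * G -> 'I_u * G -> 'I_u * G) : Prop :=
  [/\ #|G| = 2 ^ n.+1, h = (e *+ 2 ^ n)%R,
      forall k l, k < 2 ^ n.+1 -> l < 2 ^ n.+1 -> (e *+ k = e *+ l)%R -> k = l,
      steiner_op q
    & (forall x y z, q (shift e x) (shift e y) (shift e z) = shift e (q x y z))
      /\ (forall x, #|[set z | q x (anti h x) z == anti h z]| <= 4)].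

(** * The tower of doublings above a system on u points *)

Section Tower.
Variables (u j : nat).
Local Open Scope ring_scope.
Variables (col : 'I_u -> 'I_u -> option 'I_(j.*2.+1)).
Variable par : option 'I_(j.*2.+1) -> 'I_u -> 'I_u.
Hypothesis fac : factoring col par None.
Variable q0 : 'I_u -> 'I_u -> 'I_u -> 'I_u.
Hypothesis q0S : steiner_op q0.
Let X0 := ('I_u * 'I_1)%type.
Let q1 (x y z : X0) : X0 := (q0 x.1 y.1 z.1, 0).
Let rho1 (x y z : X0) : X0 := (par (oppo (col x.1 y.1)) z.1, 0).

Let q1S : steiner_op q1.
Proof.
have [q12 q23 qxx qK] := q0S.
split=> [[x ?] [y ?] [z ?]|[x ?] [y ?] [z ?]|[x ?] [y b]|[x ?] [y ?] [z c]].
- by rewrite /q1 q12.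
- by rewrite /q1 q23.
- by rewrite /q1 qxx [b]ord1.
- by rewrite /q1 qK [c]ord1.
Qed.

Let shift0 (x : X0) : shift 0 x = x.
Proof. by case: x => i a; rewrite /shift addr0. Qed.

Let rho1S : cross_op (shift (0 : 'I_1)) rho1.
Proof.
have [cC cxx pE cE] := fac.
split=> [[x ?] [y ?] [z ?]|[x ?] [z c]|[x ?] [y ?] [z c]|x y z|[x ?] [y b] [z ?]];
  rewrite ?shift0 /rho1 //=.
- by rewrite cC.
- by rewrite cxx /= -(cxx z) pE [c]ord1.
- by set g := oppo _; have := pE (par g z) z; rewrite cC cE => ->; rewrite [c]ord1.
- by rewrite cE oppoK pE [b]ord1.
Qed.

Let q1T x y z : q1 (shift 0 x) (shift 0 y) (shift 0 z) = shift 0 (q1 x y z).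
Proof. by rewrite !shift0. Qed.

Let e0 : 'I_1 := 0.

(** A block made of both copies of x and both copies of z requires the colour of {x, z} to be fixed
    by [oppo]. So z lies over x or over its neighbour of colour 0, and there are two points over
    each. *)
Let dbl1_short (x : 'I_u * twist e0) :
  (#|[set z | dbl_op q1 rho1 x (anti (tw1 e0) x) z == anti (tw1 e0) z]| <= 4)%N.
Proof.
have [cC cxx pE cE] := fac.
pose A := [set x.1; par (Some 0) x.1].
have -> : 4%N = (2 * #|{: twist e0}|)%N.
  by rewrite card_prod card_ord card_bool.
apply: leq_trans (_ : #|setX A [set: twist e0]| <= _)%N; last first.
  by rewrite cardsX cardsT leq_mul2r cards2 orbC; case: eqP.
apply/subset_leq_card/subsetP => z; rewrite /A !inE /= andbT.
have fixz i k : par (oppo (col i k)) i = k -> (k == i) || (k == par (Some 0) i).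
  move=> ek; have := cE (oppo (col i k)) i; rewrite ek => /esym/oppo_fix.
  by case=> ec; apply/orP; [left|right]; apply/eqP;
     rewrite -[LHS](pE i) ec // -(cxx i) pE.
have [x' [p ->]] := inj2P x; have [z' [s ->]] := inj2P z.
rewrite -[anti _ (inj2 _ x' p)]/(shift2 _) -[anti _ (inj2 _ z' s)]/(shift2 _).
rewrite !shift2E /dbl_op.
by case: p; case: s => /= /eqP/(congr1 fst) /= /fixz.
Qed.

Lemma cyclic_steiner_exists n : exists (G : finZmodType) (e h : G),
  exists q : 'I_u * G -> _, cyclic_steiner n e h q.
Proof.
(* The cross matchings and their freedom from short blocks are carried through the induction, since
   the next doubling uses both. *)
suff [G [e [h [q [rho [H _ _]]]]]] : exists (G : finZmodType) (e h : G),
  exists q rho : 'I_u * G -> 'I_u * G -> 'I_u * G -> 'I_u * G,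
  [/\ cyclic_steiner n e h q, cross_op (shift e) rho
    & forall x z : 'I_u * G, rho x (anti h x) z <> anti h z].
  by exists G, e, h, q.
elim: n => [|n [G [e [h [q [rho [[cG hE eI qS [qT qA]] rS rA]]]]]]].
  exists (twist e0), (tw1 e0), (tw1 e0), (dbl_op q1 rho1).
  exists (dbl_cross col par rho1); split.
  - split; first by rewrite card_prod card_ord card_bool.
    + by rewrite mulr1n.
    + by move=> [|[|k]] [|[|l]].
    + exact: dbl_steiner.
    by split=> [x y z|]; [exact: dbl_opT|exact: dbl1_short].
  - exact: dbl_crossP.
  - exact: dbl_cross_shift_neq.
exists (twist e), (tw1 e), ((h, false) : twist e).
exists (dbl_op q rho), (dbl_cross col par rho); split.
- split; first by rewrite card_prod card_bool cG mulnC -expnS.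
  + by rewrite tw1_muln hE expnS mul2n doubleK odd_double.
  + move=> k l ltk ltl; rewrite !tw1_muln => -[/eI ekl okl].
    rewrite -[k]odd_double_half -[l]odd_double_half okl ekl //;
      by rewrite -ltn_double -!mul2n -expnS; lia.
  + exact: dbl_steiner.
  by split=> [x y z|]; [exact: dbl_opT|exact: dbl_op_anti].
- exact: dbl_crossP.
- exact: dbl_cross_anti.
Qed.

End Tower.

(** * Codes from cyclic systems *)

Section Blocks.
Variables (X : finType) (q : X -> X -> X -> X).
Hypothesis qS : steiner_op q.

Definition blk x y z : {set X} := [set x; y; z; q x y z].

(** Closedness under [q] names no generating triple, so translates of blocks are blocks at once. *)
Definition is_block (B : {set X}) : bool :=
  (#|B| == 4) && [forall a in B, forall b in B, forall c in B, q a b c \in B].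

Lemma steiner_inj x y z : z != x -> z != y -> x != y ->
  [/\ q x y z != x, q x y z != y & q x y z != z].
Proof.
have [q12 q23 qxx qK] := qS => zx zy xy.
split; apply/eqP => eq1; have := qK x y z; rewrite eq1.
- by rewrite q23 qxx => ez; rewrite ez eqxx in zy.
- by rewrite q12 q23 qxx => ez; rewrite ez eqxx in zx.
have := qK x z y; rewrite [q x z y]q23 eq1 [q x z z]q12 [q z x z]q23 qxx => ez.
by rewrite ez eqxx in xy.
Qed.

Lemma card_blk x y z : z != x -> z != y -> x != y -> #|blk x y z| = 4.
Proof.
move=> zx zy xy; have [wx wy wz] := steiner_inj zx zy xy.
rewrite /blk -!setUA !cardsU1 cards1 !inE ![_ == q _ _ _]eq_sym.
by rewrite [x == z]eq_sym [y == z]eq_sym (negPf xy) (negPf zx) (negPf zy)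
   (negPf wx) (negPf wy) (negPf wz).
Qed.

Lemma blk_block x y z : z != x -> z != y -> x != y -> is_block (blk x y z).
Proof.
have [q12 q23 qxx qK] := qS => zx zy xy; rewrite /is_block card_blk //=.
(* Any three of x, y, z, w give the fourth; [H] spreads each of these four equations over the six
   orders of its arguments. *)
set w := q x y z; have H a b c d : q a b c = d ->
  (q a b c = d) * (q a c b = d) * (q b a c = d) * (q b c a = d)
  * (q c a b = d) * (q c b a = d).
  by move=> <-; do !split; rewrite // ?[q a c b]q23 // ?[q b a c]q12 //
     ?[q b c a]q23 ?[q c a b]q12 ?[q c b a]q12 // ?[q b c a]q23 ?[q a c b]q23
     // [q b a c]q12.
have [H1 H2] := (H _ _ _ _ (erefl w), H _ _ _ _ (qK x y z)).
have H3 := H _ _ _ _ (qK x z y); have H4 := H _ _ _ _ (qK y z x).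
rewrite -/(q x z y) in H3.
have e3 : q x z y = w by rewrite H1.
have e4 : q y z x = w by rewrite H1.
rewrite e3 in H3; rewrite e4 in H4; rewrite -/w in H2.
have qxyx a b : q a b a = b by rewrite q23 qxx.
have qyxx a b : q b a a = b by rewrite q12 q23 qxx.
apply/forall_inP=> a; rewrite !inE -!orbA => /or4P aB.
apply/forall_inP=> b; rewrite !inE -!orbA => /or4P bB.
apply/forall_inP=> c; rewrite !inE -!orbA => /or4P cB.
by case: aB => /eqP->; case: bB => /eqP->; case: cB => /eqP->;
  rewrite ?H1 ?H2 ?H3 ?H4 ?qxx ?qxyx ?qyxx eqxx ?orbT.
Qed.

Lemma block_eq B a b c : is_block B -> a \in B -> b \in B -> c \in B ->
  c != a -> c != b -> a != b -> B = blk a b c.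
Proof.
case/andP=> /eqP cB /forall_inP clB aB bB cBB ca cb ab.
apply/esym/eqP; rewrite eqEcard card_blk // cB andbT.
have := forall_inP (forall_inP (clB a aB) b bB) c cBB => qB.
by rewrite /blk !subUset !sub1set aB bB cBB qB.
Qed.

Lemma block_inter B B' : is_block B -> is_block B' -> 2 < #|B :&: B'| -> B = B'.
Proof.
move=> bB bB' /card_gt2P[a [b [c [[/setIP[aB aB'] /setIP[bb bb'] /setIP[cB cB']]]]]].
case=> ab bc ca; have [cb ba] : c != b /\ b != a by rewrite eq_sym bc eq_sym.
by rewrite (block_eq bB aB bb cB) // -(block_eq bB' aB' bb' cB').
Qed.

End Blocks.

Lemma card_bigcup_leq (I T : finType) (P : pred I) (F : I -> {set T}) :
  #|\bigcup_(i | P i) F i| <= \sum_(i | P i) #|F i|.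
Proof.
elim/big_rec2: _ => [|i s A _ IH]; first by rewrite cards0.
by apply: leq_trans (leq_card_setU _ _) _; rewrite leq_add2l.
Qed.

Lemma subset_card_eq (T : finType) (A : {set T}) m : m <= #|A| ->
  exists2 C : {set T}, C \subset A & #|C| = m.
Proof.
move=> lem; exists [set x in take m (enum A)].
  by apply/subsetP=> x; rewrite inE => /mem_take; rewrite mem_enum.
rewrite cardsE (card_uniqP _) ?take_uniq ?enum_uniq // size_takel //.
by rewrite -cardE.
Qed.

Section Code.
Variables (u n : nat) (G : finZmodType) (e h : G).
Let X := ('I_u * G)%type.
Variable q : X -> X -> X -> X.
Hypothesis cs : cyclic_steiner n e h q.
Local Notation v := (2 ^ n.+1).

Definition tr (r : nat) (x : X) : X := (x.1, (x.2 + e *+ r)%R).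

Let cG : #|G| = v. Proof. by case: cs. Qed.
Let hE : h = (e *+ 2 ^ n)%R. Proof. by case: cs. Qed.
Let eI k l : k < v -> l < v -> (e *+ k = e *+ l)%R -> k = l.
Proof. by case: cs => _ _ + _ _; apply. Qed.
Let qS : steiner_op q. Proof. by case: cs. Qed.

Let e_bij : bijective (fun i : 'I_v => (e *+ i)%R).
Proof.
apply: inj_card_bij; last by rewrite card_ord cG.
by move=> k l /eI ekl; apply: val_inj; apply: ekl.
Qed.

Let v_gt0 : 0 < v. Proof. by rewrite expn_gt0. Qed.

Let ev : (e *+ v = 0)%R.
Proof.
have [g gK Kg] := e_bij; have := Kg (e *+ v)%R; set r := g _ => er.
have lt_rv := ltn_ord r; case: (posnP r) => [r0|r_gt0]; first by rewrite -er r0.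
have: v - r = 0; last by lia.
apply: eI; rewrite // 1?ltn_subrL ?r_gt0 //.
by rewrite mulrnBr ?er ?subrr // ltnW.
Qed.

Let emod r : (e *+ (r %% v) = e *+ r)%R.
Proof. by rewrite {2}(divn_eq r v) mulrnDr mulnC mulrnA ev mul0rn add0r. Qed.

Let tr0 x : tr 0 x = x. Proof. by case: x => i a; rewrite /tr addr0. Qed.
Let trD r s x : tr r (tr s x) = tr (s + r) x.
Proof. by rewrite /tr /= mulrnDr addrA. Qed.
Let tr_mod r x : tr (r %% v) x = tr r x. Proof. by rewrite /tr emod. Qed.
Let trVK r x : tr (v - r %% v) (tr r x) = x.
Proof.
rewrite -(tr_mod r) trD subnKC; last by rewrite ltnW ?ltn_mod.
by rewrite -tr_mod modnn tr0.
Qed.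
Let tr_inj r : injective (tr r). Proof. exact: can_inj (trVK r). Qed.

Let tr_q r x y z : q (tr r x) (tr r y) (tr r z) = tr r (q x y z).
Proof.
have qT a b c : q (shift e a) (shift e b) (shift e c) = shift e (q a b c).
  by case: cs => _ _ _ _ [].
have trS s a : tr s.+1 a = shift e (tr s a) by rewrite /tr /shift /= mulrSr addrA.
by elim: r => [|r IHr]; rewrite ?tr0 // !trS qT IHr.
Qed.

Let trs r (B : {set X}) : {set X} := tr r @: B.

Let trsD r s B : trs r (trs s B) = trs (s + r) B.
Proof. by rewrite /trs -imset_comp; apply: eq_imset => x /=; rewrite trD. Qed.
Let trs0 B : trs 0 B = B.
Proof. by rewrite /trs (eq_imset _ tr0) imset_id. Qed.
Let trs_mod r B : trs (r %% v) B = trs r B.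
Proof. by apply: eq_imset => x; rewrite tr_mod. Qed.

Let trs_block r B : is_block q B -> is_block q (trs r B).
Proof.
case/andP=> cB /forall_inP clB; rewrite /is_block card_imset // cB.
apply/forall_inP=> _ /imsetP[a aB ->]; apply/forall_inP=> _ /imsetP[b bB ->].
apply/forall_inP=> _ /imsetP[c cBB ->]; rewrite tr_q imset_f //.
exact: (forall_inP (forall_inP (clB a aB) b bB) c cBB).
Qed.

Definition full_block B := is_block q B && (trs (2 ^ n) B != B).

Let trs_full r B : full_block B -> full_block (trs r B).
Proof.
case/andP=> bB nB; rewrite /full_block trs_block //=.
apply: contraNneq nB; rewrite trsD addnC -trsD => /imset_inj -> //.
Qed.

(* A nontrivial subgroup of a cyclic 2-group contains its involution. *)
Let full_stab r B : full_block B -> trs r B = B -> r %% v = 0.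
Proof.
case/andP=> _ nB rB; apply/eqP; rewrite -/(v %| r); apply: contraR nB => nvr.
have r_gt0 : 0 < r by case: r nvr {rB} => //; rewrite dvdn0.
have rmB m : trs (r * m) B = B.
  by elim: m => [|m IHm]; rewrite ?muln0 ?trs0 // mulnS addnC -trsD IHm rB.
have [r' od2 er] := pfactor_coprime (isT : prime 2) r_gt0.
have le_kn : logn 2 r <= n.
  rewrite leqNgt; apply: contra nvr => lt_nk; rewrite er dvdn_mull //.
  exact: dvdn_exp2l.
(* If r = r' 2^k with r' odd, this multiple of r is r' 2^n, which is congruent to 2^n modulo
   2^(n+1). *)
have := rmB (2 ^ (n - logn 2 r)).
rewrite {1}er -mulnA -expnD subnKC // -trs_mod.
rewrite coprime2n in od2; rewrite -[r']odd_double_half od2 mulnDl mul1n.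
rewrite -mul2n [2 * _]mulnC -mulnA -expnS addnC modnMDl modn_small ?ltn_exp2l //.
by move->.
Qed.

Definition orb B : {set {set X}} := [set trs (val r) B | r : 'I_v].

Let orbP B B' : reflect (exists r, B' = trs r B) (B' \in orb B).
Proof.
apply: (iffP imsetP) => [[r _ ->]|[r ->]]; first by exists r.
by exists (Ordinal (ltn_pmod r v_gt0)); rewrite //= trs_mod.
Qed.

Let orb_trs r B : orb (trs r B) = orb B.
Proof.
have sub s C : orb (trs s C) \subset orb C.
  by apply/subsetP=> D /orbP[t ->]; apply/orbP; exists (s + t); rewrite trsD.
apply/eqP; rewrite eqEsubset sub -{1}[B](_ : trs (v - r %% v) (trs r B) = _) ?sub //.
rewrite -(trs_mod r) trsD subnKC; last by rewrite ltnW ?ltn_mod.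
by rewrite -trs_mod modnn trs0.
Qed.

(** The choice depends on B only through the set [orb B], so all translates of B get the same
    representative. *)
Definition orb_rep B := odflt B [pick C in orb B].

Let orb_repP B : exists r, orb_rep B = trs r B.
Proof.
apply/orbP; rewrite /orb_rep; case: pickP => //= /(_ B) /negP[].
by apply/orbP; exists 0; rewrite trs0.
Qed.

Let orb_rep_trs r B : orb_rep (trs r B) = orb_rep B.
Proof.
rewrite /orb_rep orb_trs; case: pickP => //= /(_ B) /negP[].
by apply/orbP; exists 0; rewrite trs0.
Qed.

Definition reps := [set orb_rep B | B in full_block].

Let reps_full B : B \in reps -> full_block B /\ orb_rep B = B.
Proof.
case/imsetP=> C fC ->; have [r er] := orb_repP C.
by rewrite er orb_rep_trs er; split=> //; apply: trs_full.
Qed.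

Definition codeword (B : {set X}) : 'M[bool]_(u, v) :=
  \matrix_(i < u, k < v) ((i, (e *+ k)%R) \in B).

Let sum_card (P : pred X) :
  \sum_(i < u) \sum_(k < v) nat_of_bool (P (i, (e *+ k)%R)) = #|[set x | P x]|.
Proof.
rewrite pair_big /= -sum1dep_card [RHS]big_mkcond /=.
have [g gK Kg] := e_bij.
rewrite [RHS](reindex (fun p : 'I_u * 'I_v => (p.1, (e *+ p.2)%R))) /=.
  by apply: eq_bigr => -[i k] _ /=; case: (P _).
by exists (fun x => (x.1, g x.2)) => [[i k]|[i a]] _ /=; rewrite ?gK ?Kg.
Qed.

Lemma codeword_inj : injective codeword.
Proof.
move=> B B' eB; apply/setP=> -[i a]; have [g gK Kg] := e_bij.
by rewrite -(Kg a); have /matrixP/(_ i (g a)) := eB; rewrite !mxE.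
Qed.

Let codeword_weight B : hweight (codeword B) = #|B|.
Proof.
rewrite /hweight; under eq_bigr do under eq_bigr do rewrite mxE.
by rewrite (sum_card (fun x => x \in B)) cardsE.
Qed.

Let codeword_corr A B r : corr (codeword A) (codeword B) r = #|trs r A :&: B|.
Proof.
rewrite /corr; under eq_bigr do under eq_bigr do rewrite !mxE /= emod mulrnDr.
rewrite (sum_card (fun x => (x \in A) && (tr r x \in B))).
rewrite -(card_imset _ (tr_inj (r := r))); apply: eq_card => x.
apply/imsetP/setIP => [[y]|[/imsetP[y yA ->] yB]].
  by rewrite inE => /andP[yA yB] ->; rewrite imset_f.
by exists y; rewrite // inE yA.
Qed.

(** The correlation is the size of the intersection of a translate of one block with the other. If
    it exceeds 2 the two blocks coincide, so both codewords come from one orbit and are equal; the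
    translation then fixes a full block and is trivial. *)
Lemma reps_OOC (C : {set 'M[bool]_(u, v)}) :
  C \subset codeword @: reps -> is_OOC2D 4 2 C.
Proof.
move=> /subsetP sC; split=> [A|].
  move=> /sC/imsetP[A' /reps_full[/andP[/andP[/eqP cA _] _] _] ->].
  by rewrite codeword_weight.
move=> A B r /sC/imsetP[A' /reps_full[fA rA] ->] /sC/imsetP[B' /reps_full[fB rB] ->].
rewrite codeword_corr leqNgt => AB; apply/negP => lt2.
have [/andP[bA _] /andP[bB _]] := (fA, fB).
have eAB : trs r A' = B' := block_inter qS (trs_block r bA) bB lt2.
have eA : A' = B' by rewrite -rA -rB -eAB orb_rep_trs.
case: AB; first by rewrite eA eqxx.
by rewrite (full_stab fA) // eAB -eA.
Qed.

Let anti_tr x : anti h x = tr (2 ^ n) x. Proof. by rewrite /anti /tr hE. Qed.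

Let tr_half_neq x : tr (2 ^ n) x != x.
Proof.
apply/eqP=> /(congr1 snd) /= /(canRL (addKr _)); rewrite addNr => e0.
have: 2 ^ n = 0; last by apply/eqP; rewrite -lt0n expn_gt0.
by apply: eI; rewrite ?ltn_exp2l.
Qed.

Let tr_halfK x : tr (2 ^ n) (tr (2 ^ n) x) = x.
Proof. by rewrite trD addnn -mul2n -expnS -tr_mod modnn tr0. Qed.

(** The z for which {x, x + h, z, z + h} is a block. The bound 4 in [cyclic_steiner] also counts x
    and x + h, so two are left. *)
Let antipodes x : {set X} :=
  [set z | q x (tr (2 ^ n) x) z == tr (2 ^ n) z] :\: [set x; tr (2 ^ n) x].

Let card_antipodes x : #|antipodes x| <= 2.
Proof.
have [q12 q23 qxx qK] := qS.
have qA : #|[set z | q x (tr (2 ^ n) x) z == tr (2 ^ n) z]| <= 4.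
  by case: cs => _ _ _ _ [_ /(_ x)]; under eq_finset do rewrite !anti_tr.
rewrite /antipodes cardsDS; first by rewrite cards2 eq_sym tr_half_neq leq_subLR.
apply/subsetP=> z; rewrite !inE => /orP[]/eqP->; first by rewrite q23 qxx.
by rewrite tr_halfK q12 q23 qxx.
Qed.

Let triple (x y z : X) : 3.-tuple X := [tuple x; y; z].
Let half_pairs : {set X * X} := [set p | p.2 \in antipodes p.1].

Let card_half_pairs : #|half_pairs| <= 2 * #|{: X}|.
Proof.
rewrite -sum1dep_card.
rewrite (eq_bigl (fun p : X * X => xpredT p.1 && (p.2 \in antipodes p.1))) //.
rewrite -(pair_big_dep xpredT (fun x z => z \in antipodes x) (fun _ _ => 1)) /=.
rewrite mulnC -sum_nat_const; apply: leq_sum => x _.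
by rewrite sum1_card card_antipodes.
Qed.

(** Translation by h is an involution without fixed points, so it pairs the four points of a block
    that it preserves. Either x is paired with y or z, or x is paired with the fourth point and y
    with z. *)
Let short_cover x y z : y != x -> z != x -> z != y ->
  ~~ full_block (blk q x y z) ->
  [\/ y = tr (2 ^ n) x /\ z \in antipodes x,
      z = tr (2 ^ n) x /\ y \in antipodes x
    | z = tr (2 ^ n) y /\ x \in antipodes y].
Proof.
have [q12 q23 qxx qK] := qS; set T := tr (2 ^ n) => yx zx zy.
have xy : x != y by rewrite eq_sym.
have TK : involutive T by exact: tr_halfK.
have Tn a : T a != a by exact: tr_half_neq.
rewrite /full_block blk_block //= negbK => /eqP eB.
have TB a : a \in blk q x y z -> T a \in blk q x y z.
  by move=> aB; rewrite -[in X in _ \in X]eB imset_f.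
have [wx wy wz] := steiner_inj qS zx zy xy; set w := q x y z in wx wy wz.
have inB a : (a \in blk q x y z) = [|| a == x, a == y, a == z | a == w].
  by rewrite /blk !inE -!orbA.
have TC a b : (T a == b) = (a == T b) by apply/eqP/eqP => [<-|->]; rewrite TK.
have := TB x; rewrite !inB eqxx (negPf (Tn x)) /= => /(_ isT) /or3P[]/eqP Tx.
- apply: Or31; split=> //; rewrite !inE -/T Tx negb_or zx zy /=.
  have := TB z; rewrite !inB eqxx !orbT (negPf (Tn z)) /= => /(_ isT).
  rewrite [T z == x]TC [T z == y]TC -[T y](_ : x = _); last by rewrite -Tx TK.
  by rewrite Tx (negPf zx) (negPf zy) /= => /eqP->.
- apply: Or32; split=> //; rewrite !inE -/T Tx negb_or yx eq_sym zy /=.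
  have := TB y; rewrite !inB eqxx !orbT (negPf (Tn y)) /= => /(_ isT).
  rewrite [T y == x]TC [T y == z]TC -[T z](_ : x = _); last by rewrite -Tx TK.
  by rewrite Tx [y == z]eq_sym (negPf yx) (negPf zy) /= => /eqP->; rewrite q23.
apply: Or33; have := TB y; rewrite !inB eqxx !orbT (negPf (Tn y)) /= => /(_ isT).
rewrite [T y == x]TC [T y == w]TC -[T w](_ : x = _); last by rewrite -Tx TK.
rewrite Tx [y == w]eq_sym (negPf wy) (negPf yx) orbF /= => /eqP Ty.
split=> //; rewrite !inE -/T Ty negb_or xy eq_sym zx /=.
by rewrite q23 [q y x z]q12 Tx.
Qed.

(** Each representative has at most v translates, each with 24 ordered triples of distinct points. A
    triple in a short block consists of a pair {x, x + h} and an antipode: three arrangements with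
    at most 2w choices each. *)
Lemma card_reps (w := #|{: X}|) : w ^_ 3 <= #|reps| * (24 * v) + 6 * w.
Proof.
pose D (B : {set X}) : {set 3.-tuple X} :=
  [set t : 3.-tuple X | all (mem B) t & uniq t].
have sub : [set t : 3.-tuple X | all xpredT t & uniq t] \subset
    (\bigcup_(B in reps) \bigcup_(r < v) D (trs r B)) :|:
    ([set triple p.1 (tr (2 ^ n) p.1) p.2 | p in half_pairs] :|:
     [set triple p.1 p.2 (tr (2 ^ n) p.1) | p in half_pairs] :|:
     [set triple p.2 p.1 (tr (2 ^ n) p.1) | p in half_pairs]).
  apply/subsetP=> t; case/tupleP: t => x t; case/tupleP: t => y t.
  case/tupleP: t => z t; rewrite [t]tuple0 {t}.
  move=> tU; have /andP[/andP[xy xz] yz] : (x != y) && (x != z) && (y != z).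
    by move: tU; rewrite inE /= !inE negb_or andbT.
  have [yx zx zy] : [/\ y != x, z != x & z != y].
    by rewrite ![_ == x]eq_sym [z == y]eq_sym.
  case fB: (full_block (blk q x y z)).
    rewrite in_setU; apply/orP; left; have [r er] := orb_repP (blk q x y z).
    apply/bigcupP; exists (orb_rep (blk q x y z)); first exact: imset_f.
    have [s es] : exists s, blk q x y z = trs s (orb_rep (blk q x y z)).
      exists (v - r %% v); rewrite er -(trs_mod r) trsD subnKC.
        by rewrite -trs_mod modnn trs0.
      by rewrite ltnW ?ltn_mod.
    apply/bigcupP; exists (Ordinal (ltn_pmod s v_gt0)) => //.
    rewrite inE /= trs_mod -es /blk !inE !eqxx ?orbT /=.
    by rewrite negb_or xy xz yz.
  rewrite in_setU; apply/orP; right; have := short_cover yx zx zy (negbT fB).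
  have im (f : X * X -> 3.-tuple X) a b :
    b \in antipodes a -> f (a, b) \in f @: half_pairs.
    by move=> ab; apply: imset_f; rewrite inE.
  case=> -[-> m2]; rewrite !in_setU.
  - by rewrite (im (fun p => triple p.1 (tr (2 ^ n) p.1) p.2)).
  - by rewrite (im (fun p => triple p.1 p.2 (tr (2 ^ n) p.1))) ?orbT.
  - by rewrite (im (fun p => triple p.2 p.1 (tr (2 ^ n) p.1))) ?orbT.
have := subset_leq_card sub; rewrite card_uniq_tuples => /leq_trans; apply.
apply: leq_trans (leq_card_setU _ _) _; apply: leq_add.
  apply: leq_trans (card_bigcup_leq _ _) _; rewrite -sum_nat_const.
  apply: leq_sum => B /reps_full[/andP[/andP[/eqP cB _] _] _].
  apply: leq_trans (card_bigcup_leq _ _) _.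
  rewrite mulnC -[X in _ <= X * _]card_ord -sum_nat_const; apply: leq_sum => r _.
  by rewrite card_uniq_tuples card_imset ?cB.
have imh (f : X * X -> 3.-tuple X) : #|f @: half_pairs| <= 2 * w.
  exact: leq_trans (leq_imset_card _ _) card_half_pairs.
apply: leq_trans (leq_card_setU _ _) _.
rewrite (_ : 6 * w = 2 * w + 2 * w + 2 * w); last by lia.
apply: leq_add => //; apply: leq_trans (leq_card_setU _ _) _; exact: leq_add.
Qed.
End Code.

(** Here w = uv is 4 or 8 modulo 12, so J* is the floor of u(N-1)/4 and 24 v J* is at most 6w(N-1).
    Since 6N is at most (w-1)(w-2), the missing 6w are just available. *)
Lemma Jstar_bound u n (w := u * 2 ^ n.+1) : u %% 6 = 2 \/ u %% 6 = 4 ->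
  Jstar u (2 ^ n.+1) * (24 * 2 ^ n.+1) + 6 * w <= w ^_ 3.
Proof.
move=> u6; set v := 2 ^ n.+1 in w *.
have ev2 : v = 2 * 2 ^ n by rewrite /v expnS.
have n3 : ~~ (3 %| w).
  have v3 : 3 %| v = false by rewrite /v Euclid_dvdX.
  by rewrite /w Euclid_dvdM // v3 orbF; lia.
have w4 : 4 %| w by rewrite /w ev2; lia.
have ov : odd v = false by rewrite ev2 oddM.
have u12 : (u %% 12 == 7) || (u %% 12 == 11) = false by clear -u6; lia.
have w_gt0 : 0 < w by rewrite /w ev2 !muln_gt0 expn_gt0 andbT; clear -u6; lia.
have ew : u * v = w by []; move: ew n3 w4 w_gt0; clearbody w => ew n3 w4 w_gt0.
have w12 : (w %% 12 == 4) || (w %% 12 == 8) by clear -n3 w4; lia.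
have w_ge4 : 4 <= w by clear -w4 w_gt0; lia.
rewrite /Jstar u12 /= ew w12 ov /= orbT /Nval ew.
set N := (_ * _) %/ 3; have N6 : 6 * N <= (w - 1) * (w - 2).
  apply: (@leq_trans ((w - 1) * ((w - 2) %/ 2) * 2)).
    rewrite (_ : 6 * N = N * 3 * 2); last by rewrite -mulnA mulnC.
    by rewrite leq_mul2r leq_divM orbT.
  by rewrite -mulnA leq_mul2l leq_divM orbT.
set J := _ %/ 4; have J4 : J * 4 <= u * (N - 1) by apply: leq_divM.
have -> : w ^_ 3 = w * ((w - 1) * (w - 2)).
  by rewrite ffactnS ffactnS ffactn1 -!subn1 -subnDA.
have h1 : J * (24 * v) <= w * (6 * (N - 1)).
  have -> : J * (24 * v) = J * 4 * (6 * v) by ring.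
  have -> : w * (6 * (N - 1)) = u * (N - 1) * (6 * v) by rewrite -ew; ring.
  by rewrite leq_mul2r J4 orbT.
(* For N = 0 the truncated N - 1 leaves no room for 6w, which is then bounded through w >= 4. *)
rewrite [6 * w]mulnC; have [N0|N0] := posnP N.
  move: h1; rewrite N0 sub0n muln0 muln0 leqn0 => /eqP ->.
  rewrite add0n leq_mul2l; apply/orP; right.
  by apply: (@leq_mul 3 2); clear -w_ge4; lia.
apply: leq_trans (leq_add h1 (leqnn _)) _.
rewrite -mulnDr leq_mul2l; apply/orP; right; apply: leq_trans N6.
by clear -N0; lia.
Qed.

Lemma OOC_of_steiner u n (q : 'I_u -> 'I_u -> 'I_u -> 'I_u) :
  u %% 6 = 2 \/ u %% 6 = 4 -> steiner_op q ->
  exists C : {set 'M[bool]_(u, 2 ^ n.+1)},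
    is_OOC2D 4 2 C /\ #|C| = Jstar u (2 ^ n.+1).
Proof.
move=> u6 qS; have eu : #|'I_u| = (u./2.-1).*2.+2 by rewrite card_ord; lia.
have [col [par fac]] := factoring_exists eu.
have [G [e [h [q' cs]]]] := cyclic_steiner_exists fac qS n.
have [cG _ _ _ _] := cs.
have cX : #|{: 'I_u * G}| = u * 2 ^ n.+1 by rewrite card_prod card_ord cG.
have le_J : Jstar u (2 ^ n.+1) <= #|codeword n e @: reps n e q'|.
  rewrite card_imset; last exact: codeword_inj cs.
  have := card_reps cs; rewrite cX => /(leq_trans (Jstar_bound n u6)).
  by rewrite leq_add2r leq_mul2r muln_eq0 expn_eq0.
have [C sC cC] := subset_card_eq le_J.
by exists C; split=> //; apply: (reps_OOC cs sC).
Qed.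

(** * Candelabra systems *)

Definition steiner_order (n : nat) : Prop :=
  exists q : 'I_n -> 'I_n -> 'I_n -> 'I_n, steiner_op q.

Lemma steiner_transport (X Y : Type) (f : X -> Y) (g : Y -> X) q :
  cancel f g -> cancel g f -> steiner_op q ->
  steiner_op (fun x y z => g (q (f x) (f y) (f z))).
Proof.
move=> fK gK [q12 q23 qxx qK]; split=> [x y z|x y z|x y|x y z].
- by rewrite q12.
- by rewrite q23.
- by rewrite qxx fK.
- by rewrite gK qK fK.
Qed.

Lemma steiner_order_card (X : finType) (q : X -> X -> X -> X) :
  steiner_op q -> steiner_order #|X|.
Proof.
move=> qS; have [f [g fK gK]] := card_bijection (card_ord #|X|).
exists (fun x y z => g (q (f x) (f y) (f z))); exact: (steiner_transport _ _ qS).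
Qed.

Lemma steiner_on (X : finType) n : steiner_order n -> #|X| = n ->
  exists q : X -> X -> X -> X, steiner_op q.
Proof.
move=> [q qS] cX; have [|f [g fK gK]] := @card_bijection X 'I_n.
  by rewrite card_ord.
exists (fun x y z => g (q (f x) (f y) (f z))); exact: (steiner_transport _ _ qS).
Qed.

Section Candelabra.
Variables (Y G S : finType).

(* The groups are the [Y]-indexed copies of [G]; the stem is [S]. *)
Definition cpt : Type := ((Y * G) + S)%type.
HB.instance Definition _ := Finite.copy cpt ((Y * G) + S)%type.

Definition grp (x : cpt) : option Y := if x is inl p then Some p.1 else None.

Definition compat (o o' : option Y) : bool :=
  match o, o' with Some i, Some j => i == j | _, _ => true end.

Definition inside (x y z : cpt) : bool :=
  [&& compat (grp x) (grp y), compat (grp x) (grp z) & compat (grp y) (grp z)].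

(** The laws of a Steiner operation, for the triples not contained in one group together with the
    stem. By [cdN] a block through such a triple has no forbidden triple, so these blocks and those
    of the filled groups do not interfere. *)
Record candelabra (c : cpt -> cpt -> cpt -> cpt) : Prop := Candelabra {
  cd12 : forall x y z, ~~ inside x y z -> c x y z = c y x z;
  cd23 : forall x y z, ~~ inside x y z -> c x y z = c x z y;
  cdxx : forall x y, ~~ inside x x y -> c x x y = y;
  cdN : forall x y z, ~~ inside x y z -> ~~ inside x y (c x y z);
  cdK : forall x y z, ~~ inside x y z -> c x y (c x y z) = z }.

Lemma compatC o o' : compat o o' = compat o' o.
Proof. by case: o o' => [i|] [j|] //=; rewrite eq_sym. Qed.

Lemma inside12 x y z : inside x y z = inside y x z.
Proof. by rewrite /inside compatC [X in _ && X]andbC. Qed.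

Lemma inside23 x y z : inside x y z = inside x z y.
Proof. by rewrite /inside andbCA [compat (grp y) _]compatC. Qed.

Section Fill.
Variables (c : cpt -> cpt -> cpt -> cpt) (q : G + S -> G + S -> G + S -> G + S).
Hypotheses (cC : candelabra c) (qS : steiner_op q).
Hypothesis q_stem : forall s t r, exists r', q (inr s) (inr t) (inr r) = inr r'.

Let loc (x : cpt) : G + S :=
  match x with inl p => inl p.2 | inr s => inr s end.

Let put (d : cpt) (o : option Y) (x : G + S) : cpt :=
  match x, o with
  | inl a, Some i => inl (i, a)
  | inr s, _ => inr s
  | inl _, None => d
  end.

Let orelse (o o' : option Y) := if o is Some i then Some i else o'.
Let host (x y z : cpt) := orelse (grp x) (orelse (grp y) (grp z)).

(** A triple of stem points lies inside every group with the stem, so the copies of [q] have to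
    agree on it. They do because the stem is closed under [q], and then [put] needs no host
    group. *)
Definition fill_op x y z : cpt :=
  if inside x y z then put x (host x y z) (q (loc x) (loc y) (loc z))
  else c x y z.

Lemma fill_steiner : steiner_op fill_op.
Proof.
have [c12 c23 cxx cN cK] := cC; have [q12 q23 qxx qK] := qS.
have stemI s t a : exists b, q (inr s) (inr t) (inl a) = inl b.
  case E: (q (inr s) (inr t) (inl a)) => [b|r]; first by exists b.
  have := qK (inr s) (inr t) (inl a); rewrite E.
  by have [r' ->] := q_stem s t r.
split.
- move=> x y z; rewrite /fill_op [inside y x z]inside12.
  case: ifPn => [|nI]; last exact: c12.
  rewrite q12 /inside /host.
  case: x y z => [[i a]|s] [[j b]|t] [[k d]|r] //=; rewrite ?andbT;
    try first [by case/and3P=> /eqP<-|by move=> /eqP<-|by move=> _; case: (q _ _ _)].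
  by have [r' ->] := q_stem t s r.
- move=> x y z; rewrite /fill_op [inside x z y]inside23.
  case: ifPn => [|nI]; last exact: c23.
  rewrite q23 /inside /host.
  case: x y z => [[i a]|s] [[j b]|t] [[k d]|r] //=; rewrite ?andbT;
    try first [by case/and3P=> /eqP<-|by move=> /eqP<-|by move=> _; case: (q _ _ _)].
- move=> x y; rewrite /fill_op; case: ifPn => [|nI]; last exact: cxx.
  rewrite qxx /inside /host.
  by case: x y => [[i a]|s] [[j b]|t] //=; rewrite eqxx andbb => /eqP<-.
move=> x y z; rewrite /fill_op; have [I1|nI] := boolP (inside x y z); last first.
  by rewrite (negPf (cN _ _ _ nI)) cK.
move: I1; rewrite /inside /host.
case: x y z => [[i a]|s] [[j b]|t] [[k d]|r] //=; rewrite ?andbT.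
- case/and3P=> /eqP<- /eqP<- _; case E: (q _ _ _) => [f|f] /=;
  by rewrite !eqxx /= -E qK.
- move/eqP=> <-; case E: (q _ _ _) => [f|f] /=;
  by rewrite !eqxx /= -E qK.
- move/eqP=> <-; case E: (q _ _ _) => [f|f] /=;
  by rewrite ?eqxx /= -E qK.
- by move=> _; case E: (q _ _ _) => [f|f] /=; rewrite ?eqxx /= -E qK.
- move/eqP=> <-; case E: (q _ _ _) => [f|f] /=;
  by rewrite ?eqxx /= -E qK.
- by move=> _; case E: (q _ _ _) => [f|f] /=; rewrite ?eqxx /= -E qK.
- by move=> _; have [f E] := stemI s t d; rewrite E /= -E qK.
- by move=> _; have [f E] := q_stem s t r; rewrite E /= -E qK.
Qed.

End Fill.

End Candelabra.

Lemma candelabra_steiner_order (Y G S : finType) (c : cpt Y G S -> _)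
    (q : G + S -> G + S -> G + S -> G + S) :
  candelabra c -> steiner_op q ->
  (forall s t r, exists r', q (inr s) (inr t) (inr r) = inr r') ->
  steiner_order (#|Y| * #|G| + #|S|).
Proof.
move=> cC qS q_stem; have := steiner_order_card (fill_steiner cC qS q_stem).
by rewrite card_sum card_prod.
Qed.

(** * Substituting three-group systems for the points of a quadruple system *)

Section Weighting.
Variables (Y S : finType) (G : finZmodType).
Variable Q : option Y -> option Y -> option Y -> option Y.
Hypothesis QS : steiner_op Q.
Variable c3 : cpt 'I_3 G S -> cpt 'I_3 G S -> cpt 'I_3 G S -> cpt 'I_3 G S.
Hypothesis c3C : candelabra c3.
Local Notation P := (cpt Y G S).
Local Notation P3 := (cpt 'I_3 G S).

(** The lines are the triples of the Steiner triple system derived from [Q] at the point [None]. *)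
Definition cone (B : {set Y}) : {set option Y} := None |: [set Some y | y in B].
Definition is_line (B : {set Y}) : bool := is_block Q (cone B).

Lemma mem_cone B y : (Some y \in cone B) = (y \in B).
Proof. by rewrite !inE mem_imset //; apply: Some_inj. Qed.

Lemma line_card B : is_line B -> #|B| = 3.
Proof.
case/andP=> /eqP + _; rewrite cardsU1 card_imset; last exact: Some_inj.
by case: imsetP => [[]|_] //= [].
Qed.

Lemma line_through x y : x != y ->
  exists B, [/\ is_line B, x \in B & y \in B].
Proof.
move=> xy; pose D := blk Q None (Some x) (Some y).
have bD : is_block Q D by apply: blk_block => //=; rewrite eq_sym.
exists [set z | Some z \in D]; rewrite !inE !eqxx ?orbT; split=> //.
rewrite /is_line (_ : cone _ = D) //; apply/setP=> -[z|].
  by rewrite mem_cone inE.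
by rewrite /cone /D !inE !eqxx.
Qed.

Lemma line_unique B B' x y : is_line B -> is_line B' -> x != y ->
  x \in B -> y \in B -> x \in B' -> y \in B' -> B = B'.
Proof.
move=> lB lB' xy xB yB xB' yB'; have: cone B = cone B'.
  apply: (block_inter QS lB lB'); apply/card_gt2P.
  exists None, (Some x), (Some y); split; last by rewrite eq_sym; split.
  by rewrite !inE !eqxx !mem_imset ?xB ?yB ?xB' ?yB' //; apply: Some_inj.
by move=> eB; apply/setP=> z; rewrite -!mem_cone eB.
Qed.

Definition groups (x y z : P) : {set Y} :=
  [set i | [|| grp x == Some i, grp y == Some i | grp z == Some i]].

Definition line_of (x y z : P) : option {set Y} :=
  [pick B | is_line B && (groups x y z \subset B)].

Lemma line_of12 x y z : line_of x y z = line_of y x z.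
Proof.
by rewrite /line_of (_ : groups x y z = groups y x z) //;
   apply/setP=> i; rewrite !inE orbCA.
Qed.

Lemma line_of23 x y z : line_of x y z = line_of x z y.
Proof.
by rewrite /line_of (_ : groups x y z = groups x z y) //;
   apply/setP=> i; rewrite !inE [X in _ || X]orbC.
Qed.

Lemma insidePn x y z : ~~ inside x y z ->
  exists i j, [/\ i != j, i \in groups x y z & j \in groups x y z].
Proof.
rewrite /inside !negb_and; case: x y z => [[i a]|s] [[j b]|t] [[k d]|r] //=;
  rewrite ?orbF //.
- by case/or3P=> ne; [exists i, j|exists i, k|exists j, k]; split;
     rewrite // !inE !eqxx ?orbT.
- by move=> ne; exists i, j; split; rewrite // !inE !eqxx ?orbT.
- by move=> ne; exists i, k; split; rewrite // !inE !eqxx ?orbT.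
- by move=> ne; exists j, k; split; rewrite // !inE !eqxx ?orbT.
Qed.

(** The numbering of the three groups depends on the set B alone, so the copy of [c3] on B is
    symmetric in its arguments although [c3] may treat its groups differently. *)
Let lab (B : {set Y}) (y : Y) : 'I_3 := inord (index y (enum B)).
Let unlab (d : Y) (B : {set Y}) (i : 'I_3) : Y := nth d (enum B) i.

Let labK d B y : is_line B -> y \in B -> unlab d B (lab B y) = y.
Proof.
move=> lB yB; rewrite /unlab /lab inordK ?nth_index ?mem_enum //.
by rewrite -[X in _ < X](line_card lB) cardE index_mem mem_enum.
Qed.

Let unlabK d B i : is_line B -> lab B (unlab d B i) = i.
Proof.
move=> lB; rewrite /unlab /lab index_uniq ?enum_uniq ?inord_val //.
by rewrite -cardE (line_card lB).
Qed.

Let unlab_in d B i : is_line B -> unlab d B i \in B.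
Proof. by move=> lB; rewrite -mem_enum mem_nth // -cardE (line_card lB). Qed.

Let lab_inj B x y : is_line B -> x \in B -> y \in B -> (lab B x == lab B y) = (x == y).
Proof.
move=> lB xB yB; apply/eqP/eqP=> [exy|->//].
by rewrite -(labK x lB xB) exy labK.
Qed.

Let to3 (B : {set Y}) (x : P) : P3 :=
  match x with inl p => inl (lab B p.1, p.2) | inr s => inr s end.
Let of3 (d : Y) (B : {set Y}) (x : P3) : P :=
  match x with inl p => inl (unlab d B p.1, p.2) | inr s => inr s end.

Let on_line (B : {set Y}) (x : P) : bool :=
  if grp x is Some i then i \in B else true.

Let to3K d B x : is_line B -> on_line B x -> of3 d B (to3 B x) = x.
Proof. by case: x => [[i a]|s] //= lB iB; rewrite labK. Qed.

Let of3K d B x : is_line B -> to3 B (of3 d B x) = x.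
Proof. by case: x => [[i a]|s] //= lB; rewrite unlabK. Qed.

Let of3_on d B x : is_line B -> on_line B (of3 d B x).
Proof. by case: x => [[i a]|s] //= lB; apply: unlab_in. Qed.

Let inside_to3 B x y z : is_line B -> on_line B x -> on_line B y -> on_line B z ->
  inside (to3 B x) (to3 B y) (to3 B z) = inside x y z.
Proof.
move=> lB; case: x y z => [[i a]|s] [[j b]|t] [[k d]|r] //= iB jB kB;
  by rewrite /inside /= ?lab_inj.
Qed.

Let groups_on (B : {set Y}) x y z : groups x y z \subset B ->
  [/\ on_line B x, on_line B y & on_line B z].
Proof.
move/subsetP=> sB; split.
- by case: x sB => [[i a]|s] //= sB; apply: sB; rewrite !inE eqxx.
- by case: y sB => [[i a]|s] //= sB; apply: sB; rewrite !inE eqxx ?orbT.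
- by case: z sB => [[i a]|s] //= sB; apply: sB; rewrite !inE eqxx ?orbT.
Qed.

Let on_groups (B : {set Y}) x y z : on_line B x -> on_line B y -> on_line B z ->
  groups x y z \subset B.
Proof.
move=> xB yB zB; apply/subsetP=> i; rewrite inE.
by case/or3P=> /eqP E; [move: xB|move: yB|move: zB]; rewrite /on_line E.
Qed.

Let line_ofP x y z B : ~~ inside x y z -> is_line B -> on_line B x ->
  on_line B y -> on_line B z -> line_of x y z = Some B.
Proof.
move=> /insidePn[i [j [ij iG jG]]] lB xB yB zB.
have /subsetP sB := on_groups xB yB zB; rewrite /line_of.
case: pickP => [B' /andP[lB' /subsetP sB']|/(_ B)]; last first.
  by rewrite lB (introT subsetP sB).
congr Some; apply: (line_unique lB' lB ij); by [apply: sB|apply: sB'].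
Qed.

(* The blocks of [Q] through [None] are replaced by copies of [c3], with the
   stem in place of [None]; the other ones by the quadruples with sum zero. *)
Definition weight_op (x y z : P) : P :=
  if line_of x y z is Some B then
    if [pick i in B] is Some d then of3 d B (c3 (to3 B x) (to3 B y) (to3 B z))
    else x
  else match x, y, z with
  | inl p, inl p', inl p'' =>
    if Q (Some p.1) (Some p'.1) (Some p''.1) is Some t
    then inl (t, - (p.2 + p'.2 + p''.2))%R else x
  | _, _, _ => x
  end.

Let weight_line x y z B : line_of x y z = Some B -> exists d,
  [/\ is_line B, on_line B x, on_line B y, on_line B z
    & weight_op x y z = of3 d B (c3 (to3 B x) (to3 B y) (to3 B z))].
Proof.
move=> E; rewrite /weight_op E; move: E; rewrite /line_of.
case: pickP => // B' /andP[lB /groups_on[xB yB zB]] [<-].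
case: pickP => [d _|B0]; first by exists d.
by have := line_card lB; rewrite (eq_card0 B0).
Qed.

(** Two groups always lie on a line, so a triple without a line meets three groups, and the block of
    [Q] through these avoids [None]. *)
Let weight_noline x y z : ~~ inside x y z -> line_of x y z = None ->
  exists i j k t a b d, [/\ x = inl (i, a), y = inl (j, b), z = inl (k, d),
    Q (Some i) (Some j) (Some k) = Some t & [/\ i != j, i != k & j != k]].
Proof.
move=> nI E.
have pair a b : groups x y z \subset [set a; b] -> False.
  move=> sG; have [i' [j' [ij iG jG]]] := insidePn nI.
  have ab : a != b.
    apply: contraNneq ij => eab; move/subsetP: sG => sG.
    by have := sG i' iG; have := sG j' jG; rewrite eab !inE !orbb => /eqP-> /eqP->.
  have [B [lB aB bB]] := line_through ab.
  move: E; rewrite /line_of; case: pickP => // /(_ B).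
  by rewrite lB (subset_trans sG) // subUset !sub1set aB bB.
have noline i j k : groups x y z = [set i; j; k] ->
    [/\ i != j, i != k, j != k & Q (Some i) (Some j) (Some k) != None].
  move=> eG; have nij : i != j.
    by apply/negP=> /eqP eij; apply: (pair j k); rewrite eG eij setUid.
  have nik : i != k.
    by apply/negP=> /eqP eik; apply: (pair k j); rewrite eG eik setUAC setUid.
  have njk : j != k.
    by apply/negP=> /eqP ejk; apply: (pair i k); rewrite eG ejk -setUA setUid.
  split=> //; apply/negP=> /eqP Q0; have [B [lB iB jB]] := line_through nij.
  have kB : k \in B.
    have bQ : is_block Q (blk Q (Some i) (Some j) (Some k)).
      by apply: blk_block => //; rewrite eq_sym.
    have eB : cone B = blk Q (Some i) (Some j) (Some k).
      apply: (block_inter QS lB bQ); apply/card_gt2P.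
      exists None, (Some i), (Some j); split; last by rewrite eq_sym; split.
      rewrite !in_setI !mem_cone iB jB /blk Q0 /cone !inE !eqxx ?orbT.
      by split.
    by rewrite -mem_cone eB !inE eqxx ?orbT.
  move: E; rewrite /line_of; case: pickP => // /(_ B).
  by rewrite lB eG !subUset !sub1set iB jB kB.
move: nI E noline pair; rewrite /groups.
have osym (i l : Y) : (Some i == Some l) = (l == i) by rewrite eq_sym.
case: x y z => [[i a]|s] [[j b]|t] [[k d]|r] //= nI E noline pair.
- have [|ij ik jk] := noline i j k.
    by apply/setP=> l; rewrite !inE !osym orbA.
  case EQ: (Q _ _ _) => [t|] // _; exists i, j, k, t, a, b, d; split=> //.
- by case: (pair i j); apply/subsetP=> l; rewrite !inE !osym orbF.
- by case: (pair i k); apply/subsetP=> l; rewrite !inE !osym.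
- by case: (pair j k); apply/subsetP=> l; rewrite !inE !osym.
Qed.

Lemma weight_candelabra : candelabra weight_op.
Proof.
have [c12 c23 cxx cN cK] := c3C; have [Q12 Q23 Qxx QK] := QS.
have w12 x y z : ~~ inside x y z -> weight_op x y z = weight_op y x z.
  move=> nI; case E: (line_of x y z) => [B|].
    have [d [lB xB yB zB _]] := weight_line E.
    rewrite /weight_op -(line_of12 x y z) E; case: pickP => [d' _|B0].
      by rewrite c12 // inside_to3.
    by have := line_card lB; rewrite (eq_card0 B0).
  have [i [j [k [t [a [b [f [ex ey ez EQ _]]]]]]]] := weight_noline nI E.
  rewrite /weight_op -(line_of12 x y z) E ex ey ez /=.
  by rewrite [Q (Some j) _ _]Q12 EQ [(b + a)%R]addrC.
have w23 x y z : ~~ inside x y z -> weight_op x y z = weight_op x z y.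
  move=> nI; case E: (line_of x y z) => [B|].
    have [d [lB xB yB zB _]] := weight_line E.
    rewrite /weight_op -(line_of23 x y z) E; case: pickP => // d' _.
    by rewrite c23 // inside_to3.
  have [i [j [k [t [a [b [f [ex ey ez EQ _]]]]]]]] := weight_noline nI E.
  by rewrite /weight_op -(line_of23 x y z) E ex ey ez /= [Q _ (Some k) _]Q23 EQ addrAC.
have wL x y z B : ~~ inside x y z -> line_of x y z = Some B ->
    ~~ inside x y (weight_op x y z) /\ weight_op x y (weight_op x y z) = z.
  move=> nI E; have [d [lB xB yB zB ew]] := weight_line E.
  have wB : on_line B (weight_op x y z) by rewrite ew of3_on.
  have nI3 : ~~ inside (to3 B x) (to3 B y) (to3 B z) by rewrite inside_to3.
  have ew3 : to3 B (weight_op x y z) = c3 (to3 B x) (to3 B y) (to3 B z).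
    by rewrite ew of3K.
  have nIw : ~~ inside x y (weight_op x y z).
    by rewrite -(inside_to3 lB xB yB wB) ew3 cN.
  split=> //; have E' := line_ofP nIw lB xB yB wB.
  have [d' [_ _ _ _ ->]] := weight_line E'.
  by rewrite ew3 cK // to3K.
have wN x y z : ~~ inside x y z ->
    ~~ inside x y (weight_op x y z) /\ weight_op x y (weight_op x y z) = z.
  move=> nI; case E: (line_of x y z) => [B|]; first exact: wL nI E.
  have [i [j [k [t [a [b [f [ex ey ez EQ [ij ik jk]]]]]]]]] := weight_noline nI E.
  have ew : weight_op x y z = inl (t, - (a + b + f))%R.
    by rewrite /weight_op E ex ey ez /= EQ.
  have nIw : ~~ inside x y (weight_op x y z).
    by rewrite ew ex ey /inside /= (negPf ij).
  split=> //; have EQ' : Q (Some i) (Some j) (Some t) = Some k by rewrite -EQ QK.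
  (* A line through i, j and t would form with [None] the block of [Q] through them. That block also
     contains k, so i, j, k would be on a line. *)
  case E': (line_of x y (weight_op x y z)) => [B|].
    have [d [lB iB jB tB _]] := weight_line E'.
    move: iB jB tB; rewrite ew ex ey /on_line /= => iB jB tB.
    have tij : Some t != Some i /\ Some t != Some j.
      have [|||? ? _] := @steiner_inj _ Q QS (Some i) (Some j) (Some k);
        by rewrite -?EQ // eq_sym.
    have eB : cone B = blk Q (Some i) (Some j) (Some t).
      by apply: block_eq => //; rewrite ?mem_cone //; case: tij.
    have kB : k \in B by rewrite -mem_cone eB /blk EQ' !inE eqxx ?orbT.
    by have := line_ofP nI lB; rewrite E ex ey ez => /(_ iB jB kB).
  rewrite {1}/weight_op E' ew ex ey ez /= EQ'; congr (inl (_, _)).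
  by rewrite opprD opprK addKr.
split=> // [x y nI|x y z /wN[]|x y z /wN[]] //.
have [i [j [ij iG jG]]] := insidePn nI.
case E: (line_of x x y) => [B|].
  have [d [lB xB _ yB ->]] := weight_line E.
  by rewrite cxx ?inside_to3 // to3K.
have [? [? [? [? [? [? [? [ex ex' _ _ [+ _ _]]]]]]]]] := weight_noline nI E.
by move: ex'; rewrite ex => -[-> _]; rewrite eqxx.
Qed.

End Weighting.

(** * Four groups and a stem of size two *)

Section DistinctOp.
Variables (Y G S : finType) (m : cpt Y G S -> cpt Y G S -> cpt Y G S -> cpt Y G S).

(** Repeated points are dealt with here once, so that each construction has to be verified on three
    distinct points only. *)
Definition distinct_op x y z : cpt Y G S :=
  if x == y then z else if x == z then y else if y == z then x else m x y z.

Hypothesis m12 : forall x y z, ~~ inside x y z -> m x y z = m y x z.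
Hypothesis m23 : forall x y z, ~~ inside x y z -> m x y z = m x z y.
Hypothesis mK : forall x y z, ~~ inside x y z -> x != y -> x != z -> y != z ->
  [/\ m x y z != x, m x y z != y, ~~ inside x y (m x y z)
    & m x y (m x y z) = z].

Lemma distinct_candelabra : candelabra distinct_op.
Proof.
have comp_xx (o : option Y) : compat o o by case: o => //= i.
have ins_xyx (x y : cpt Y G S) : inside x y x = inside x y y.
  by rewrite /inside !comp_xx andbT [compat (grp y) _]compatC andbb.
split=> [x y z nI|x y z nI|x y nI|x y z nI|x y z nI]; rewrite /distinct_op.
- rewrite [y == x]eq_sym; case: (eqVneq x y) => // xy.
  case: (eqVneq x z) => [exz|xz]; case: (eqVneq y z) => [eyz|yz] //.
    by rewrite exz eyz eqxx in xy.
  exact: m12.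
- rewrite [z == y]eq_sym; case: (eqVneq x y) => [<-|xy]; case: (eqVneq x z) => //.
  by case: (eqVneq y z) => // yz xz; apply: m23.
- by rewrite eqxx.
- case: (eqVneq x y) => [//|xy]; case: (eqVneq x z) => [exz|xz].
    by rewrite -ins_xyx {2}exz.
  case: (eqVneq y z) => [eyz|yz]; first by rewrite ins_xyx {2}eyz.
  by have [] := mK nI xy xz yz.
- have [//|xy] := eqVneq x y; have [<-|xz] := eqVneq x z.
    by rewrite eqxx (negPf xy).
  have [<-|yz] := eqVneq y z; first by rewrite eqxx.
  have [wx wy _ wK] := mK nI xy xz yz.
  by rewrite ![_ == m x y z]eq_sym (negPf wx) (negPf wy).
Qed.

End DistinctOp.

Section Quadrupling.
Variables (G : finZmodType) (C : Type).
Local Open Scope ring_scope.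
Variables (col : G -> G -> C) (par : C -> G -> G) (c0 : C).
Hypothesis fac : factoring col par c0.
Variables (one : G) (od hi : G -> bool) (lift : G -> bool -> G).
Hypothesis odD : forall a b, od (a + b) = od a (+) od b.
Hypothesis od1 : od one.
Hypothesis hi_lift : forall a b, hi (lift a b) = b.
Hypothesis liftK : forall a b, ~~ od a -> lift a b + lift a b = a.
Hypothesis lift_dbl : forall a, lift (a + a) (hi a) = a.

Let P := cpt (bool * bool)%type G bool.
Let pt s t a : P := inl ((s, t), a).

Let bit (b : bool) : G := if b then one else 0.
Let od0 : od 0 = false. Proof. by have := odD 0 0; rewrite addr0; case: (od 0). Qed.
Let odN a : od (- a) = od a.
Proof. by have := odD a (- a); rewrite subrr od0; case: (od a); case: (od (- a)). Qed.
Let od_bit b : od (bit b) = b. Proof. by case: b; rewrite /bit ?od0. Qed.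

(** Chosen for two identities. The sum of [sgn s t t'] and [sgn s t (~~ t')] is t, which makes
    [transop] symmetric in its ends; the sum of [sgn s t t'] and [sgn (~~ s) t' t] is 1, so that of
    two points in adjacent groups exactly one is the centre of their block through a given stem
    point. *)
Let sgn (s t t' : bool) : bool := if s then ~~ (t && t') else t && t'.
(** In the cyclic group of even order that is meant, doubling forgets precisely the bit [hi].
    Putting this bit back as the parity makes [xi t a] a bijection, with inverse [sol t a]. *)
Let xi (t : bool) (a c : G) : G := a + c + (a + c) + bit (hi a (+) hi c (+) t).
Let sol (t : bool) (b x : G) : G :=
  lift (x - bit (od x) - (b + b)) (hi b (+) t (+) od x).

Let xiC t a c : xi t a c = xi t c a.
Proof. by rewrite /xi [a + c]addrC [hi a (+) _]addbC. Qed.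

Let od_xi t a c : od (xi t a c) = hi a (+) hi c (+) t.
Proof. by rewrite /xi odD od_bit odD addbb. Qed.

Let xi_sol t b x : xi t b (sol t b x) = x.
Proof.
have E : forall h t o : bool, h (+) (h (+) t (+) o) (+) t = o by do 3!case.
rewrite /xi /sol hi_lift E addrACA liftK; last first.
  by rewrite !odD !odN !odD od_bit !addbb.
by rewrite [b + b + _]addrC subrK subrK.
Qed.

Let sol_uniq t b c : sol t b (xi t b c) = c.
Proof.
have E : forall h t o : bool, h (+) t (+) (h (+) o (+) t) = o by do 3!case.
rewrite /sol od_xi E.
by rewrite /xi addrK addrACA [b + b + _]addrC addrK lift_dbl.
Qed.

(* The groups (s, 0) and (s, 1) are opposite: on them the blocks are given by
   a one-factorization.  Otherwise a block has its centre in a group (s, t) and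
   its ends [a], [c] in the two groups (~~ s, _); its remaining two points [b],
   [b'] lie in the centre group and have the sum [xi t a c].  When this forces
   b = b', both [b] and the other half of [xi t a c] are left over, and each
   gets a stem point instead; [sgn] decides which one, in such a way that every
   pair of points of adjacent groups is joined once to each stem point. *)
Let pairop s t a a' s2 t2 b : P :=
  if s == s2 then pt s2 t2 (par (col a a') b) else pt s2 (~~ t2) (sol t b (a + a')).

Let transop s t b t1 a c : P :=
  if xi t a c - b == b then inr (hi b (+) hi a (+) sgn s t t1)
  else pt s t (xi t a c - b).

Let stemop h s t a s2 t2 b : P :=
  if s == s2 then
    pt (~~ s) (hi a (+) hi b)
       (lift (a + b + (a + b)) (hi a (+) sgn (~~ s) (hi a (+) hi b) t (+) h))
  else if hi a == hi b (+) sgn s t t2 (+) h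
  then pt s2 (~~ t2) (lift (a + a - (b + b)) (hi b (+) t))
  else pt s (~~ t) (lift (b + b - (a + a)) (hi a (+) t2)).

Let quad (x y z : P) : P :=
  match x, y, z with
  | inl ((s1, t1), a), inl ((s2, t2), b), inl ((s3, t3), c) =>
    if (s1 == s2) && (t1 == t2) then pairop s1 t1 a b s3 t3 c
    else if (s1 == s3) && (t1 == t3) then pairop s1 t1 a c s2 t2 b
    else if (s2 == s3) && (t2 == t3) then pairop s2 t2 b c s1 t1 a
    else if s1 == s2 then transop s3 t3 c t1 a b
    else if s1 == s3 then transop s2 t2 b t1 a c
    else transop s1 t1 a t2 b c
  | inl ((s1, t1), a), inl ((s2, t2), b), inr h => stemop h s1 t1 a s2 t2 b
  | inl ((s1, t1), a), inr h, inl ((s2, t2), b) => stemop h s1 t1 a s2 t2 b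
  | inr h, inl ((s1, t1), a), inl ((s2, t2), b) => stemop h s1 t1 a s2 t2 b
  | _, _, _ => x
  end.

Let pairC s t a a' s2 t2 b : pairop s t a a' s2 t2 b = pairop s t a' a s2 t2 b.
Proof. by case: fac => colC _ _ _; rewrite /pairop colC [a + a']addrC. Qed.

(** A double is even, so the ends of a block through the stem determine which of the two possible
    groups holds its centre; [stemop] relies on this. *)
Let dbl_even t a c b : xi t a c - b = b -> hi a (+) hi c = t.
Proof.
move=> /(canRL (subrK _)) E; have := od_xi t a c.
have K : forall h k o : bool, false = h (+) k (+) o -> h (+) k = o by do 3!case.
by rewrite E odD addbb => /K.
Qed.

Let transC s t b t1 a c : transop s t b t1 a c = transop s t b (~~ t1) c a.
Proof.
rewrite /transop xiC; case: eqP => // /dbl_even <-; congr inr.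
by case: s t1 (hi b) (hi a) (hi c) => [] [] [] [] [].
Qed.

Let stemC h s t a s2 t2 b : (s, t) != (s2, t2) ->
  stemop h s t a s2 t2 b = stemop h s2 t2 b s t a.
Proof.
rewrite /stemop [s2 == s]eq_sym; case: (eqVneq s s2) => [<-|ns].
  rewrite xpair_eqE eqxx /= => nt; rewrite [a + b]addrC [hi a (+) hi b]addbC.
  have -> : t2 = ~~ t by case: t t2 nt => [] [].
  have E : forall s t ha hb h : bool, ha (+) sgn (~~ s) (hb (+) ha) t (+) h =
    hb (+) sgn (~~ s) (hb (+) ha) (~~ t) (+) h by do 5!case.
  by rewrite E.
have -> : s2 = ~~ s by case: s s2 ns => [] [].
have E : forall s t t2 ha hb h : bool, (hb == ha (+) sgn (~~ s) t2 t (+) h) =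
  ~~ (ha == hb (+) sgn s t t2 (+) h) by do 6!case.
by rewrite E; case: (hi a == _).
Qed.

Let quad12 x y z : ~~ inside x y z -> quad x y z = quad y x z.
Proof.
case: x y z => [[[s1 t1] a]|h1] [[[s2 t2] b]|h2] [[[s3 t3] c]|h3] //=; last first.
- by rewrite /inside /= !andbT; apply: stemC.
case: s1; case: t1; case: s2; case: t2; case: s3; case: t3 => //= _;
  by [exact: pairC | exact: transC].
Qed.

Let quad23 x y z : ~~ inside x y z -> quad x y z = quad x z y.
Proof.
case: x y z => [[[s1 t1] a]|h1] [[[s2 t2] b]|h2] [[[s3 t3] c]|h3] //=; last first.
- by rewrite /inside /= ; apply: stemC.
case: s1; case: t1; case: s2; case: t2; case: s3; case: t3 => //= _;
  by [exact: pairC | exact: transC].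
Qed.
Let recovers x y z : Prop :=
  [/\ quad x y z != x, quad x y z != y, ~~ inside x y (quad x y z)
    & quad x y (quad x y z) = z].

Let recovers_sym x y z : ~~ inside x y z -> recovers y x z -> recovers x y z.
Proof.
move=> nI; rewrite /recovers -(quad12 nI) => -[wy wx nIw wK].
by split=> //; rewrite ?[inside x y _]inside12 // quad12 // inside12.
Qed.

Let pt_neq s t a s' t' a' : (s, t) != (s', t') -> pt s t a != pt s' t' a'.
Proof. by apply: contraNneq => -[-> -> _]. Qed.

Let parK a b c : par (col a b) (par (col a b) c) = c.
Proof.
have [cC _ pE cE] := fac; set g := col a b.
by have := pE (par g c) c; rewrite cC cE.
Qed.

Let parD a b c : par (col b (par (col a c) b)) a = c.
Proof. by have [cC _ pE cE] := fac; rewrite cE pE. Qed.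

Let par_neq a b c : a != c -> par (col a c) b != b.
Proof.
have [cC cxx pE cE] := fac; apply: contraNneq => eb; apply/eqP.
by rewrite -[RHS](pE a) -(cE (col a c) b) eb cxx -(cxx a) pE.
Qed.

Let solK t b x : sol t (sol t b x) x = b.
Proof. by rewrite -[X in sol _ _ X](xi_sol t b x) xiC sol_uniq. Qed.

Let trans_sol s t t1 a b c : a != c ->
  transop s t a t1 b (sol t b (a + c)) = pt s t c.
Proof.
move=> ac; rewrite /transop xi_sol [a + c]addrC addrK.
by rewrite eq_sym (negPf ac).
Qed.

Let recovers_opp s t a b c : a != b -> recovers (pt s t a) (pt s t b) (pt s (~~ t) c).
Proof.
move=> ab; case: s; case: t; rewrite /recovers /quad /=;
  by split; rewrite // ?pt_neq //; congr inl; rewrite /= parK.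
Qed.

Let recovers_adj s t t2 a b c :
  recovers (pt s t a) (pt s t b) (pt (~~ s) t2 c).
Proof.
case: s; case: t; case: t2; rewrite /recovers /quad /=;
  by split; rewrite // ?pt_neq //; congr inl; rewrite /= solK.
Qed.

Let recovers_opp2 s t a b c : a != c ->
  recovers (pt s t a) (pt s (~~ t) b) (pt s t c).
Proof.
move=> ac; case: s; case: t; rewrite /recovers /quad /=;
  (split; [by rewrite ?pt_neq| |by []|by congr inl; rewrite /= parD]);
  by apply/eqP=> -[/eqP]; rewrite (negPf (par_neq _ ac)).
Qed.

Let recovers_adj2 s t t2 a b c : a != c ->
  recovers (pt s t a) (pt (~~ s) t2 b) (pt s t c).
Proof.
move=> ac; case: s; case: t; case: t2; rewrite /recovers /quad /=;
  by split; rewrite ?pt_neq // ?trans_sol.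
Qed.

Let nI_opp s t a b x : ~~ inside (pt s t a) (pt s (~~ t) b) x.
Proof. by case: s; case: t. Qed.
Let nI_adj s t t2 a b x : ~~ inside (pt s t a) (pt (~~ s) t2 b) x.
Proof. by case: s; case: t; case: t2. Qed.

Let recovers_center s t t' a b c :
  recovers (pt s t a) (pt s (~~ t) b) (pt (~~ s) t' c).
Proof.
have E : quad (pt s t a) (pt s (~~ t) b) (pt (~~ s) t' c)
         = transop (~~ s) t' c t a b by case: s; case: t; case: t'.
rewrite /recovers E /transop; case: (xi t' a b - c =P c) => [e2|n2].
  have et := dbl_even e2; split=> //.
  rewrite /= /stemop eqxx et; congr (pt _ _ _).
  have -> : a + b + (a + b) = c + c.
    by rewrite -{1}e2 subrK /xi et addbb addr0.
  rewrite -[RHS]lift_dbl; congr lift.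
  have K : forall x y z : bool, x (+) y (+) (z (+) x (+) y) = z by do 3!case.
  exact: K.
split=> //; try by rewrite pt_neq //; case: s {E}; case: t.
have -> : quad (pt s t a) (pt s (~~ t) b) (pt (~~ s) t' (xi t' a b - c))
         = transop (~~ s) t' (xi t' a b - c) t a b.
  by clear; case: s; case: t; case: t'.
rewrite /transop opprB addrC subrK; case: eqP => // e2; case: n2.
by rewrite -{1}e2.
Qed.

Let recovers_end s t t2 a b c :
  recovers (pt s t a) (pt (~~ s) t2 b) (pt s (~~ t) c).
Proof.
have E : quad (pt s t a) (pt (~~ s) t2 b) (pt s (~~ t) c)
         = transop (~~ s) t2 b t a c by case: s; case: t; case: t2.
rewrite /recovers E /transop; case: (xi t2 a c - b =P b) => [e2|n2].
  have et := dbl_even e2; split=> //.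
  rewrite /= /stemop (_ : s == ~~ s = false); last by case: s {E}.
  have K : forall s x y t t2 : bool, (x == y (+) sgn s t t2 (+)
    (y (+) x (+) sgn (~~ s) t2 t)) = false by do 5!case.
  rewrite K; congr (pt _ _ _); have -> : b + b - (a + a) = c + c.
    by rewrite -{1}e2 subrK /xi et addbb addr0 addrACA [a + a + _]addrC addrK.
  rewrite -[RHS]lift_dbl; congr lift; rewrite -et.
  by case: (hi a); case: (hi c).
split=> //; first by rewrite pt_neq; case: s {E}.
  by apply/eqP=> -[].
have -> : quad (pt s t a) (pt (~~ s) t2 b) (pt (~~ s) t2 (xi t2 a c - b))
  = pairop (~~ s) t2 b (xi t2 a c - b) s t a.
  by clear; case: s; case: t; case: t2.
rewrite /pairop (_ : ~~ s == s = false); last by case: s {E}.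
by rewrite addrC subrK sol_uniq.
Qed.

Let recovers_stem s t a b h : recovers (pt s t a) (pt s (~~ t) b) (inr h).
Proof.
rewrite /recovers -[quad _ _ (inr h)]/(stemop _ _ _ _ _ _ _) /stemop eqxx.
set t' := hi a (+) hi b; set c := lift _ _.
split=> //; try by rewrite pt_neq // xpair_eqE; case: s {c}.
have -> : forall c, quad (pt s t a) (pt s (~~ t) b) (pt (~~ s) t' c)
         = transop (~~ s) t' c t a b.
  by move=> c'; case: s {c}; case: t; case: t'.
have e2 : xi t' a b - c = c.
  apply/eqP; rewrite subr_eq liftK; last by rewrite odD addbb.
  by rewrite /xi -/t' addbb addr0.
rewrite /transop e2 eqxx; congr inr; rewrite hi_lift.
by case: (hi a); case: (sgn _ _ _); case: h {c e2}.
Qed.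

Let recovers_stem2 s t t2 a b h : recovers (pt s t a) (pt (~~ s) t2 b) (inr h).
Proof.
have ns : (s == ~~ s) = false by case: s.
rewrite /recovers -[quad _ _ (inr h)]/(stemop _ _ _ _ _ _ _) /stemop ns.
case: ifPn => hab.
  split=> //; try by rewrite pt_neq // xpair_eqE; case: s {ns hab}; case: t2.
  have E c : quad (pt s t a) (pt (~~ s) t2 b) (pt (~~ s) (~~ t2) c)
           = transop s t a t2 b c by case: s {ns hab}; case: t; case: t2.
  rewrite E; set c := lift _ _.
  have e2 : xi t b c - a = a.
    apply/eqP; rewrite subr_eq /xi addrACA liftK; last by rewrite !odD odN odD !addbb.
    have K : forall x y : bool, x (+) (x (+) y) (+) y = false by do 2!case.
    by rewrite hi_lift K addr0 [b + b + _]addrC subrK.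
  rewrite /transop e2 eqxx; congr inr; rewrite (eqP hab).
  have K : forall x y z : bool, x (+) y (+) z (+) x (+) y = z by do 3!case.
  exact: K.
split=> //; try by rewrite pt_neq // xpair_eqE; case: s {ns hab}; case: t.
have E c : quad (pt s t a) (pt (~~ s) t2 b) (pt s (~~ t) c)
         = transop (~~ s) t2 b t a c by case: s {ns hab}; case: t; case: t2.
rewrite E; set c := lift _ _.
have e2 : xi t2 a c - b = b.
  apply/eqP; rewrite subr_eq /xi addrACA liftK; last by rewrite !odD odN odD !addbb.
  have K : forall x y : bool, x (+) (x (+) y) (+) y = false by do 2!case.
  by rewrite hi_lift K addr0 [a + a + _]addrC subrK.
rewrite /transop e2 eqxx; congr inr.
have K : forall s t t2 x y h : bool, x != y (+) sgn s t t2 (+) h ->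
   y (+) x (+) sgn (~~ s) t2 t = h by do 6!case.
exact: K hab.
Qed.

Let recovers_of_stem s t a b h : recovers (inr h) (pt s t a) (pt s (~~ t) b).
Proof.
have ns : (s == ~~ s) = false by case: s.
rewrite /recovers /= /stemop eqxx; set t' := hi a (+) hi b; set c := lift _ _.
split=> //; first by rewrite pt_neq // xpair_eqE eq_sym ns.
  by rewrite inside12 inside23 nI_adj.
rewrite /= /stemop ns hi_lift.
have K : forall s t t' x h : bool, (x == x (+) sgn (~~ s) t' t (+) h
  (+) sgn s t t' (+) h) = false by do 5!case.
rewrite K liftK; last by rewrite odD addbb.
rewrite addrACA [a + a + _]addrC addrK -[in RHS](lift_dbl b); congr (pt _ _ (lift _ _)).
by rewrite /t'; case: (hi a); case: (hi b).
Qed.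

Let recovers_of_stem2 s t t2 a b h : recovers (inr h) (pt s t a) (pt (~~ s) t2 b).
Proof.
have ns : (s == ~~ s) = false by case: s.
rewrite /recovers /= /stemop ns; case: ifPn => hab.
  split=> //; first by rewrite pt_neq // xpair_eqE eq_sym ns.
    by rewrite inside12 inside23 nI_adj.
  rewrite /= /stemop ns hi_lift (eqP hab).
  have K : forall s t t2 x h : bool, x (+) sgn s t t2 (+) h ==
    x (+) t (+) sgn s t (~~ t2) (+) h by do 5!case.
  rewrite K negbK liftK; last by rewrite !odD odN odD !addbb.
  rewrite opprB addrCA subrr addr0 -[in RHS](lift_dbl b); congr (pt _ _ (lift _ _)).
  by case: (hi b); case: t {hab K}.
split=> //; first by rewrite pt_neq // xpair_eqE eqxx; case: t {hab}.
  by rewrite inside12 inside23 nI_opp.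
rewrite /= /stemop eqxx hi_lift.
have K1 : forall x y : bool, x (+) (x (+) y) = y by do 2!case.
rewrite K1; congr (pt _ _ _); rewrite -[RHS]lift_dbl; congr lift.
  rewrite addrACA liftK; last by rewrite !odD odN odD !addbb.
  by rewrite addrC subrK.
have K : forall s t t2 x y h : bool, x != y (+) sgn s t t2 (+) h ->
   x (+) sgn (~~ s) t2 t (+) h = y by do 6!case.
exact: K hab.
Qed.

Let negbP (b b' : bool) : {b' = b} + {b' = ~~ b}.
Proof. by case: b; case: b'; [left|right|right|left]. Qed.

Let quadK x y z : ~~ inside x y z -> x != y -> x != z -> y != z -> recovers x y z.
Proof.
case: x y z => [[[s t] a]|h1] [[[s2 t2] b]|h2] [[[s3 t3] c]|h3] nI //.
- rewrite -!/(pt _ _ _) in nI *.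
  case: (negbP s s2) nI => ->; last first.
    case: (negbP s s3) => ->.
      case: (negbP t t3) => -> _ _ xz _; last exact: recovers_end.
      by apply: recovers_adj2; apply: contraNneq xz => ->.
    case: (negbP t2 t3) => -> nI _ _ yz; apply: recovers_sym => //.
      have := @recovers_adj2 (~~ s) t2 t b a c; rewrite negbK; apply.
      by apply: contraNneq yz => ->.
    by have := @recovers_end (~~ s) t2 t b a c; rewrite negbK.
  case: (negbP t t2) => ->.
    case: (negbP s s3) => ->; last by move=> *; apply: recovers_adj.
    case: (negbP t t3) => -> nI xy _ _; first by rewrite /inside /= eqxx in nI.
    by apply: recovers_opp; apply: contraNneq xy => ->.
  case: (negbP s s3) => ->; last by move=> *; apply: recovers_center.
  case: (negbP t t3) => -> nI _ xz yz.
    by apply: recovers_opp2; apply: contraNneq xz => ->.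
  apply: recovers_sym => //.
  have := @recovers_opp2 s (~~ t) b a c; rewrite negbK; apply.
  by apply: contraNneq yz => ->.
- move: nI; rewrite -!/(pt _ _ _).
  case: (negbP s s2) => ->; last by move=> *; apply: recovers_stem2.
  case: (negbP t t2) => -> nI _ _ _; last exact: recovers_stem.
  by rewrite /inside /= eqxx in nI.
- move: nI; rewrite -!/(pt _ _ _) => nI _ _ _; apply: recovers_sym => //.
  move: nI; case: (negbP s s3) => ->; last by move=> *; apply: recovers_of_stem2.
  case: (negbP t t3) => -> nI; last exact: recovers_of_stem.
  by rewrite /inside /= eqxx in nI.
- move: nI; rewrite -!/(pt _ _ _) => nI _ _ _.
  move: nI; case: (negbP s2 s3) => ->; last by move=> *; apply: recovers_of_stem2.
  case: (negbP t2 t3) => -> nI; last exact: recovers_of_stem.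
  by rewrite /inside /= eqxx in nI.
Qed.

Lemma quadrupling_candelabra : exists c : P -> P -> P -> P, candelabra c.
Proof.
exists (distinct_op quad); apply: distinct_candelabra.
- exact: quad12.
- exact: quad23.
- exact: quadK.
Qed.

End Quadrupling.

Lemma odd_Zp_add k (a b : 'I_(k.*2.+2)) : odd (a + b)%R = odd a (+) odd b.
Proof.
rewrite /= -oddD modn_def; case: edivnP => r d -> /=.
by rewrite oddD oddM /= negbK odd_double andbF.
Qed.

Lemma quadrupling k : exists c : cpt (bool * bool)%type 'I_(k.*2.+2) bool -> _,
  candelabra c.
Proof.
have [col [par fac]] := @factoring_exists 'I_(k.*2.+2) k (card_ord _).
(* The two halves of an even residue differ by k + 1, and [hi] tells them apart. *)
pose n := k.*2.+2; pose hi (a : 'I_n) := k.+1 <= a.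
pose lift (a : 'I_n) (b : bool) : 'I_n := inord (a./2 + (if b then k.+1 else 0)).
have vlift a b : lift a b = a./2 + (if b then k.+1 else 0) :> nat.
  by rewrite inordK // /n; case: a => a /= lt_a; case: b; rewrite /n in lt_a; lia.
apply: (quadrupling_candelabra fac (one := inord 1) (od := fun a => odd a)
  (hi := hi) (lift := lift)).
- exact: odd_Zp_add.
- by rewrite inordK.
- move=> a b; rewrite /hi vlift; case: a => a /= lt_a; rewrite /n in lt_a.
  by case: b; lia.
- move=> a b ev_a; apply: val_inj; rewrite /= !vlift.
  have -> : a./2 + (if b then k.+1 else 0) + (a./2 + (if b then k.+1 else 0))
         = a + (if b then k.*2.+2 else 0) by move: ev_a; case: b; lia.
  have lt_a := ltn_ord a; case: b; last by rewrite addn0 modn_small.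
  by rewrite modnDr modn_small.
- move=> a; apply: ord_inj; rewrite vlift /= /hi; have lt_a := ltn_ord a.
  case: (leqP k.+1 a) => ka; last by rewrite modn_small; lia.
  have -> : a + a = (a + a - k.*2.+2) + k.*2.+2 by lia.
  by rewrite modnDr modn_small; lia.
Qed.

Lemma small_stem_closed (G S : finType) (q : G + S -> G + S -> G + S -> G + S) :
  #|S| <= 2 -> steiner_op q ->
  forall s t r, exists r', q (inr s) (inr t) (inr r) = inr r'.
Proof.
move=> cS [q12 q23 qxx _] s t r.
case: (eqVneq s t) => [->|st]; first by exists r; rewrite qxx.
case: (eqVneq s r) => [->|sr]; first by exists t; rewrite q23 qxx.
case: (eqVneq t r) => [->|tr]; first by exists s; rewrite q12 q23 qxx.
suff: 2 < #|S| by rewrite ltnNge cS.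
by apply/card_gt2P; exists s, t, r; split; rewrite // [r == s]eq_sym.
Qed.

Lemma steiner_order_quadruple k :
  steiner_order (k.*2.+2 + 2) -> steiner_order (4 * k.*2.+2 + 2).
Proof.
move=> /(@steiner_on ('I_(k.*2.+2) + bool)%type) [|q qS].
  by rewrite card_sum card_ord card_bool.
have [c cC] := quadrupling k.
have := candelabra_steiner_order cC qS (small_stem_closed _ qS).
by rewrite card_prod card_ord !card_bool; apply.
Qed.

(** * Three groups *)

Section Tripling.
Variables (G : finComNzRingType) (S : finType).
Local Open Scope ring_scope.
(* A transversal with sum [r] is completed by a stem point if [stem r], and
   otherwise by moving its point in the group [cen r] by [dl r]. *)
Variables (ksum : S -> G) (stem : G -> option S) (cen : G -> 'I_3) (dl : G -> G).
Variables (hd : 'I_3 -> G -> option G) (mt : G -> G -> G -> G).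
Hypothesis stemP : forall r s, stem r = Some s <-> r = ksum s.
Hypothesis dlP : forall r, stem r = None ->
  [/\ stem (r + dl r) = None, cen (r + dl r) = cen r, dl (r + dl r) = - dl r
    & dl r != 0].
Hypothesis hdP : forall i d r,
  hd i d = Some r <-> [/\ stem r = None, cen r = i & dl r = d].
Hypothesis hd_None : forall i j d, hd i d = None -> hd j d = None.
Hypothesis mtC : forall a a' b, mt a a' b = mt a' a b.
Hypothesis mtK : forall a a' b, mt a a' (mt a a' b) = b.
Hypothesis mtP : forall i a a' b, a != a' -> hd i (a' - a) = None ->
  [/\ mt a a' b != b, hd i (mt a a' b - b) = None & mt b (mt a a' b) a = a'].

Let P := cpt 'I_3 G S.
Let pt (i : 'I_3) (a : G) : P := inl (i, a).
(** Uses 0 + 1 + 2 = 0 in Z/3. *)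
Let third (i j : 'I_3) : 'I_3 := - (i + j).

Let third_neq i j : i != j -> third i j != i /\ third i j != j.
Proof. by case: i j => [[|[|[|//]]] ?] [[|[|[|//]]] ?]. Qed.
Let thirdC i j : third i j = third j i. Proof. by rewrite /third addrC. Qed.
Let thirdK i j : third i (third i j) = j.
Proof. by rewrite /third opprD opprK addKr. Qed.
Let thirdP i j k : i != j -> i != k -> j != k -> k = third i j.
Proof.
by case: i j k => [[|[|[|//]]] ?] [[|[|[|//]]] ?] [[|[|[|//]]] ?] // _ _ _;
  apply/eqP.
Qed.

(** If the difference a' - a occurs as a displacement in group i, the pair lies in a block with its
    other two points in different groups, and the sum r locates the fourth point. Otherwise the
    block has two points in each of two groups; this needs [hd_None], that the same differences
    occur in all groups. *)
Let pairop i a a' j b : P :=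
  if hd i (a' - a) is Some r then pt (third i j) (r - (a + b)) else pt j (mt a a' b).

Let transop i a j b k c : P :=
  let r := a + b + c in
  if stem r is Some s then inr s
  else if cen r == i then pt i (a + dl r)
  else if cen r == j then pt j (b + dl r) else pt k (c + dl r).

Let tri (x y z : P) : P :=
  match x, y, z with
  | inl (i, a), inl (j, b), inl (k, c) =>
    if i == j then pairop i a b k c
    else if i == k then pairop i a c j b
    else if j == k then pairop j b c i a
    else transop i a j b k c
  | inl (i, a), inl (j, b), inr s
  | inl (i, a), inr s, inl (j, b)
  | inr s, inl (i, a), inl (j, b) => pt (third i j) (ksum s - (a + b))
  | _, _, _ => x
  end.

Let hd_opp i d r : hd i d = Some r -> hd i (- d) = Some (r + d).
Proof.
move/hdP=> [nr <- <-]; have [nr' cr' dr' _] := dlP nr.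
by apply/hdP; rewrite nr' cr' dr'.
Qed.

Let pairC i a a' j b : pairop i a a' j b = pairop i a' a j b.
Proof.
rewrite /pairop -[a - a']opprB; case E: (hd i (a' - a)) => [r|].
  by rewrite (hd_opp E); congr (pt _ _); ring.
case E': (hd i (- (a' - a))) => [r|]; last by rewrite mtC.
by move/hd_opp: E'; rewrite opprK E.
Qed.
Let transC12 i a j b k c : i != j ->
  transop i a j b k c = transop j b i a k c.
Proof.
move=> ij; rewrite /transop [a + b]addrC; case: (stem _) => // .
by case: eqP => [->|//]; rewrite (negPf ij).
Qed.

Let transC23 i a j b k c : i != j -> i != k -> j != k ->
  transop i a j b k c = transop i a k c j b.
Proof.
move=> ij ik jk; rewrite /transop [a + b + c]addrAC; set r := a + c + b.
case: (stem _) => //.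
case: (eqVneq (cen r) i) => // ni; case: (eqVneq (cen r) j) => [->|nj].
  by rewrite (negPf jk).
have -> : cen r = k; last by rewrite eqxx.
by rewrite [RHS](thirdP ij ik jk); apply: thirdP; rewrite // eq_sym.
Qed.

Let tri12 x y z : ~~ inside x y z -> tri x y z = tri y x z.
Proof.
case: x y z => [[i a]|s] [[j b]|t] [[k c]|r] //= _; last by rewrite thirdC [a + b]addrC.
rewrite [j == i]eq_sym; case: (eqVneq i j) => [->|ij]; first exact: pairC.
case: (eqVneq i k) => [<-|ik].
  by rewrite [j == i]eq_sym (negPf ij).
case: (eqVneq j k) => // jk; exact: transC12.
Qed.

Let tri23 x y z : ~~ inside x y z -> tri x y z = tri x z y.
Proof.
case: x y z => [[i a]|s] [[j b]|t] [[k c]|r] //= nI; last first.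
  by rewrite thirdC [b + c]addrC.
case: (eqVneq i j) nI => [<-|ij]; case: (eqVneq i k) => [<-|ik] //=.
- by rewrite /inside /= eqxx.
- rewrite [k == j]eq_sym; case: (eqVneq j k) => [<-|jk] _; first exact: pairC.
  exact: transC23.
Qed.

Let recovers x y z : Prop :=
  [/\ tri x y z != x, tri x y z != y, ~~ inside x y (tri x y z)
    & tri x y (tri x y z) = z].

Let recovers_sym x y z : ~~ inside x y z -> recovers y x z -> recovers x y z.
Proof.
move=> nI; rewrite /recovers -(tri12 nI) => -[wy wx nIw wK].
by split=> //; rewrite ?[inside x y _]inside12 // tri12 // inside12.
Qed.

Let pt_neq i a j b : i != j -> pt i a != pt j b.
Proof. by apply: contraNneq => -[->]. Qed.
Let pt_neq2 i a b : a != b -> pt i a != pt i b.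
Proof. by apply: contraNneq => -[->]. Qed.

Let nI_pt i j a b x : i != j -> ~~ inside (pt i a) (pt j b) x.
Proof. by move=> ij; rewrite /inside /= (negPf ij). Qed.

Let recovers_same i k a b c : i != k -> a != b ->
  recovers (pt i a) (pt i b) (pt k c).
Proof.
move=> ik ab; have E l d : tri (pt i a) (pt i b) (pt l d) = pairop i a b l d.
  by rewrite /= eqxx.
have nI l d : i != l -> ~~ inside (pt i a) (pt i b) (pt l d).
  by move=> il; rewrite inside23 nI_pt.
have [li lk] := third_neq ik; rewrite eq_sym in li.
rewrite /recovers E /pairop; case H: (hd i (b - a)) => [r|].
  rewrite E /pairop H thirdK; split; rewrite ?nI // 1?eq_sym ?pt_neq //.
  by congr (pt _ _); ring.
by rewrite E /pairop H mtK; split; rewrite ?nI // eq_sym pt_neq.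
Qed.

Let recovers_pair i j a b c : i != j -> a != c ->
  recovers (pt i a) (pt j b) (pt i c).
Proof.
move=> ij ac.
have E : tri (pt i a) (pt j b) (pt i c) = pairop i a c j b.
  by rewrite /= (negPf ij) eqxx.
have [li lj] := third_neq ij.
rewrite /recovers E /pairop; case H: (hd i (c - a)) => [r|].
  split; rewrite ?pt_neq ?nI_pt //.
  rewrite /= (negPf ij) ![_ == third _ _]eq_sym (negPf li) (negPf lj).
  rewrite /transop addrC subrK; move/hdP: H => [-> -> ->].
  by rewrite eqxx addrC subrK.
have [nb nh mD] := mtP b ac H.
split; rewrite ?nI_pt ?pt_neq2 // 1?eq_sym ?pt_neq //.
by rewrite /= (negPf ij) eqxx /pairop (hd_None _ nh) mD.
Qed.

Let recovers_trans i j a b c : i != j ->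
  recovers (pt i a) (pt j b) (pt (third i j) c).
Proof.
move=> ij; have [li lj] := third_neq ij.
have E d : tri (pt i a) (pt j b) (pt (third i j) d) = transop i a j b (third i j) d.
  by rewrite /= (negPf ij) ![_ == third _ _]eq_sym (negPf li) (negPf lj).
rewrite /recovers E /transop; set r := a + b + c.
case H: (stem r) => [s|].
  split; rewrite // ?nI_pt // /tri; congr (pt _ _).
  by move/stemP: H => <-; rewrite /r addrC addKr.
have [nr cr dr d0] := dlP H.
have an x : x + dl r != x by rewrite -subr_eq0 addrAC subrr add0r.
case: (eqVneq (cen r) i) => [ci|ni].
  split; rewrite ?pt_neq2 ?pt_neq ?nI_pt //.
  rewrite /= (negPf ij) eqxx /pairop addrAC subrr add0r.
  have -> : hd i (dl r) = Some r by apply/hdP.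
  by congr (pt _ _); rewrite /r addrC addKr.
case: (eqVneq (cen r) j) => [cj|nj].
  split; rewrite ?pt_neq2 ?nI_pt // 1?eq_sym ?pt_neq //.
  rewrite /= (negPf ij) eqxx /pairop addrAC subrr add0r.
  have -> : hd j (dl r) = Some r by apply/hdP.
  by rewrite thirdC; congr (pt _ _); rewrite /r; ring.
split; rewrite ?pt_neq ?nI_pt // E /transop addrA -/r nr cr dr.
by rewrite (negPf ni) (negPf nj) addrK.
Qed.

Let recovers_stem i j a b s : i != j -> recovers (pt i a) (pt j b) (inr s).
Proof.
move=> ij; have [li lj] := third_neq ij.
have E : tri (pt i a) (pt j b) (inr s) = pt (third i j) (ksum s - (a + b)) by [].
rewrite /recovers E; split; rewrite ?pt_neq ?nI_pt //.
rewrite /= (negPf ij) ![_ == third _ _]eq_sym (negPf li) (negPf lj).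
by rewrite /transop addrC subrK (proj2 (stemP _ s)).
Qed.

Let recovers_of_stem i j a b s : i != j -> recovers (inr s) (pt i a) (pt j b).
Proof.
move=> ij; have [li lj] := third_neq ij.
have E k c : tri (inr s) (pt i a) (pt k c) = pt (third i k) (ksum s - (a + c)) by [].
rewrite /recovers !E thirdK; split; rewrite ?pt_neq //.
  by rewrite inside12 inside23 nI_pt // eq_sym.
by congr (pt _ _); ring.
Qed.

Let triK x y z : ~~ inside x y z -> x != y -> x != z -> y != z -> recovers x y z.
Proof.
case: x y z => [[i a]|s] [[j b]|t] [[k c]|r] nI //; move: nI;
  rewrite -?/(pt _ _) => nI xy xz yz.
- case: (eqVneq i j) nI xy => [<-|ij] nI xy.
    apply: recovers_same; last by apply: contraNneq xy => ->.
    by apply: contraNneq nI => ->; rewrite /inside /= eqxx.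
  case: (eqVneq i k) xz => [<-|ik] xz.
    by apply: recovers_pair => //; apply: contraNneq xz => ->.
  case: (eqVneq j k) yz nI => [<-|jk] yz nI.
    apply: recovers_sym => //; apply: recovers_pair; first by rewrite eq_sym.
    by apply: contraNneq yz => ->.
  by rewrite (thirdP ij ik jk); apply: recovers_trans.
- by apply: recovers_stem; apply: contraNneq nI => ->; rewrite /inside /= eqxx.
- apply: recovers_sym => //; apply: recovers_of_stem.
  by apply: contraNneq nI => ->; rewrite /inside /= eqxx.
- by apply: recovers_of_stem; apply: contraNneq nI => ->; rewrite /inside /= eqxx.
Qed.

Lemma tripling_candelabra : exists c : P -> P -> P -> P, candelabra c.
Proof.
exists (distinct_op tri); apply: distinct_candelabra.
- exact: tri12.
- exact: tri23.
- exact: triK.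
Qed.

End Tripling.

(** * One-factors that avoid prescribed odd differences *)

Section ParityMatching.
Variable G : finComNzRingType.
Local Open Scope ring_scope.
Variables (od : G -> bool) (e : G) (H : G -> bool).
Hypothesis odD : forall a b, od (a + b) = od a (+) od b.
Hypothesis od_e : od e.
Hypothesis HN : forall d, H (- d) = H d.
Hypothesis H_odd : forall d, H d -> od d.
Hypothesis He : ~~ H e.

Let ev (a : G) : G := if od a then a - e else a.
Let flat (a a' : G) : bool := (od a == od a') || (ev a == ev a').

(* One-factors of the complete graph on [G] minus the edges with difference
   in [H]: with a = ev a + (od a) e, the edges inside a parity class and the
   edges {x, x + e} are sorted by the sum of the [ev]s, the other ones by the
   difference from the even to the odd end. *)
Definition parity_mate (a a' b : G) : G :=
  if flat a a' then
    let b' := ev a + ev a' - ev b in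
    if b' == ev b then (if od b then b - e else b + e)
    else (if od b then b' + e else b')
  else
    let d := if od a then a - a' else a' - a in
    if od b then b - d else b + d.

Let od0 : od 0 = false.
Proof. by have := odD 0 0; rewrite addr0; case: (od 0). Qed.
Let odN a : od (- a) = od a.
Proof. by have := odD a (- a); rewrite subrr od0; case: (od a); case: (od (- a)). Qed.
Let odB a b : od (a - b) = od a (+) od b. Proof. by rewrite odD odN. Qed.
Let od_ev a : od (ev a) = false.
Proof. by rewrite /ev; case E: (od a); rewrite ?odB ?E ?od_e. Qed.
Let evK a : a = ev a + (if od a then e else 0).
Proof. by rewrite /ev; case: (od a); rewrite ?subrK ?addr0. Qed.
Let ev_inj a b : ev a = ev b -> od a = od b -> a = b.
Proof. by move=> E1 E2; rewrite (evK a) E1 E2 -evK. Qed.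

Let mk (x : G) (p : bool) : G := if p then x + e else x.
Let od_mk x p : od x = false -> od (mk x p) = p.
Proof. by rewrite /mk; case: p => // ox; rewrite odD ox od_e. Qed.
Let ev_mk x p : od x = false -> ev (mk x p) = x.
Proof. by move=> ox; rewrite /ev od_mk // /mk; case: p; rewrite ?addrK. Qed.
Let mk_ev a : mk (ev a) (od a) = a.
Proof. by rewrite /mk /ev; case: (od a); rewrite ?subrK. Qed.

Let mateE a a' b : flat a a' -> parity_mate a a' b =
  let b' := ev a + ev a' - ev b in mk b' (od b (+) (b' == ev b)).
Proof.
move=> fl; rewrite /parity_mate fl /=; case: eqP => [->|_]; last by rewrite addbF.
by rewrite addbT /mk /ev; case: (od b).
Qed.

Let od_sum a a' b : od (ev a + ev a' - ev b) = false.
Proof. by rewrite odB odD !od_ev. Qed.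

Let slope (a a' : G) := if od a then a - a' else a' - a.

Let mateN a a' b : flat a a' = false -> parity_mate a a' b =
  if od b then b - slope a a' else b + slope a a'.
Proof. by rewrite /parity_mate => ->. Qed.

Let flatC a a' : flat a a' = flat a' a.
Proof. by rewrite /flat eq_sym [ev a == _]eq_sym. Qed.

Let od_slope a a' : flat a a' = false -> od (slope a a').
Proof.
by rewrite /flat /slope; case E: (od a); case E': (od a') => // _; rewrite odB E E'.
Qed.

Let slopeC a a' : flat a a' = false -> slope a a' = slope a' a.
Proof. by rewrite /flat /slope; case: (od a); case: (od a'). Qed.

Lemma parity_mateC a a' b : parity_mate a a' b = parity_mate a' a b.
Proof.
have fC := flatC a' a; case fl: (flat a a') fC => fC.
  by rewrite !mateE // [ev a + _]addrC.
by rewrite !mateN // slopeC.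
Qed.

Lemma parity_mateK a a' b : parity_mate a a' (parity_mate a a' b) = b.
Proof.
case fl: (flat a a'); last first.
  rewrite !mateN //; case ob: (od b).
    by rewrite odB ob (od_slope fl) /= subrK.
  by rewrite odD ob (od_slope fl) /= addrK.
rewrite !mateE //= ev_mk ?od_sum // od_mk ?od_sum //.
rewrite opprB addrC subrK [ev b == _]eq_sym.
by rewrite -addbA addbb addbF mk_ev.
Qed.

(** Edges within a parity class have even differences and the edges {x, x + e} have difference e up
    to sign, none of them in [H]. The remaining edges are grouped by their odd slope: one factor
    consists of all edges of one slope, and slopes in [H] are left out. *)
Lemma parity_mateP a a' b : a != a' -> ~~ H (a' - a) ->
  [/\ parity_mate a a' b != b, ~~ H (parity_mate a a' b - b)
    & parity_mate b (parity_mate a a' b) a = a'].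
Proof.
move=> aa' nH; case fl: (flat a a'); last first.
  have os := od_slope fl; have nHs : ~~ H (slope a a').
    by rewrite /slope; case: (od a); rewrite // -opprB HN.
  have fl' : flat b (parity_mate a a' b) = false.
    apply: negbTE; rewrite /flat negb_or mateN //.
    have nee : slope a a' != e.
      apply: contraFneq fl => es; rewrite /flat; apply/orP; right.
      move: es; rewrite /slope /ev; have := os; rewrite /slope.
      by case E: (od a); case E': (od a'); rewrite ?odB ?E ?E' // => _ <-;
         apply/eqP; ring.
    case E: (od b); rewrite ?odB ?odD E os /=; apply: contraNneq nee => e1.
      apply/eqP; move: e1; rewrite /ev odB E os /= => e1.
      by have -> : e = b - (b - e); [ring|rewrite e1; ring].
    apply/eqP; move: e1; rewrite /ev odD E os /= => e1.
    by have -> : e = b + slope a a' - (b + slope a a' - e); [ring|rewrite -e1; ring].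
  have sb : slope b (parity_mate a a' b) = slope a a'.
    by rewrite {1}/slope mateN //; case: (od b); ring.
  split.
  - rewrite mateN //; apply: contraTneq os => e1; have := congr1 od e1.
    by case: ifP => ob; rewrite ?odB ?odD ob; case: (od _).
  - rewrite mateN //; case: (od b); first by rewrite addrAC subrr add0r HN.
    by rewrite addrAC subrr add0r.
  - rewrite mateN // sb; move: fl; rewrite /flat /slope.
    by case: (od a) => // _; ring.
have os := od_sum a a' b; rewrite (mateE _ fl) /=; set b' := _ - ev b in os *.
have evm := ev_mk (od b (+) (b' == ev b)) os.
have odm := od_mk (od b (+) (b' == ev b)) os.
split.
- case: (eqVneq b' (ev b)) evm odm => [eb|nb] evm odm.
    apply/eqP=> e1; have := congr1 od e1.
    by rewrite odm; case: (od b).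
  by apply: contraNneq nb => e1; rewrite -evm e1.
- case: (eqVneq b' (ev b)) => [eb|nb].
    rewrite addbT eb /mk /ev; case ob: (od b) => /=.
      by rewrite (_ : b - e - b = - e) ?HN //; ring.
    by rewrite (_ : b + e - b = e) //; ring.
  rewrite addbF; apply: contraTN isT => /H_odd; rewrite odB od_mk //.
  by case: (od b).
rewrite mateE; last first.
  by rewrite /flat evm odm; case: (eqVneq b' (ev b)) => _; rewrite ?orbT // addbF eqxx.
rewrite /= evm (_ : ev b + b' - ev a = ev a'); last by rewrite /b'; ring.
rewrite -[RHS]mk_ev; congr mk.
case: (eqVneq (ev a') (ev a)) => [ea|na].
  have : od a != od a'.
    by apply: contraNneq aa' => oa; apply/eqP; apply: ev_inj.
  by case: (od a); case: (od a').
by move: fl; rewrite /flat [ev a == _]eq_sym (negPf na) orbF addbF => /eqP.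
Qed.

End ParityMatching.

(** * Three groups of order 6t + s with a stem of size s *)

Section NestedTripling.
Variables (k s t : nat).
Local Notation n := k.*2.+2.
Hypothesis nE : n = 6 * t + s.
Hypothesis t_gt0 : 0 < t.
Let G := 'I_n.

(* The sums 0, ..., 6t - 1 form three intervals of length 2t, one for each
   centre, and are matched by reflecting each interval: the differences that
   occur are +-1, +-3, ..., +-(2t - 1), the same ones for each centre. *)
Let mir (r : nat) : nat := r %/ (2 * t) * (2 * t) + (2 * t - 1 - r %% (2 * t)).
Let stem (r : G) : option 'I_s := if 6 * t <= r then insub (r - 6 * t) else None.
Let ksum (c : 'I_s) : G := inord (6 * t + c).
Let cen (r : G) : 'I_3 := inord (r %/ (2 * t)).
Let dl (r : G) : G := (inord (mir r) - r)%R.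
Let hd (i : 'I_3) (d : G) : option G :=
  [pick r | [&& stem r == None, cen r == i & dl r == d]].
Let H (d : G) : bool := odd d && ((d < 2 * t) || (n - d < 2 * t)).

Let lt6 m : m < 6 * t -> m < n. Proof. by lia. Qed.

Let stemP r c : stem r = Some c <-> r = ksum c.
Proof.
have lt_c := ltn_ord c; have lt_r := ltn_ord r.
rewrite /stem /ksum; split=> [|->]; last first.
  rewrite inordK; last by rewrite nE ltn_add2l.
  by rewrite leq_addr addKn valK.
case: leqP => // le_r; case: insubP => // c' _ ec [<-].
by apply: ord_inj; rewrite inordK ec subnKC // nE -nE.
Qed.

Let stem_small r : stem r = None <-> r < 6 * t.
Proof.
have lt_r := ltn_ord r; rewrite /stem; case: leqP => // le_r.
split=> //; case: insubP => // /negP[]; lia.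
Qed.

Let blockP r : r < 6 * t -> exists q x, [/\ q < 3, x < 2 * t, r = q * (2 * t) + x
  & r %/ (2 * t) = q /\ mir r = q * (2 * t) + (2 * t - 1 - x)].
Proof.
move=> lt_r; exists (r %/ (2 * t)), (r %% (2 * t)); split=> //.
- by rewrite ltn_divLR; lia.
- by rewrite ltn_pmod; lia.
- exact: divn_eq.
Qed.

Let block_div q x : x < 2 * t -> (q * (2 * t) + x) %/ (2 * t) = q.
Proof. by move=> ltx; rewrite divnMDl ?divn_small ?addn0 //; lia. Qed.

Let block_lt q x : q < 3 -> x < 2 * t -> q * (2 * t) + x < 6 * t.
Proof. by case: q => [|[|[|//]]] _; lia. Qed.

(** Reflecting the offset x to 2t - 1 - x moves it by 2t - 1 - 2x, here reduced modulo n; the number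
    q of the interval drops out. *)
Let dl_val (r : G) q x : q < 3 -> x < 2 * t -> r = q * (2 * t) + x :> nat ->
  dl r = (if x < t then 2 * t - 1 - 2 * x else n + 2 * t - 1 - 2 * x) :> nat.
Proof.
move=> q3 x2 er.
have em : mir r = q * (2 * t) + (2 * t - 1 - x).
  by rewrite /mir er block_div // modnMDl modn_small.
have ltm : mir r < 6 * t by rewrite em block_lt //; lia.
set v := (if _ then _ else _).
have ltv : v < n by rewrite /v; case: ifP; lia.
rewrite (_ : dl r = inord v) ?inordK //; apply/eqP; rewrite subr_eq; apply/eqP.
apply: ord_inj; rewrite /= !inordK //; last exact: lt6.
rewrite /v em er; case: ltnP => xt.
  by rewrite modn_small; have := block_lt q3 x2; lia.
have -> : n + 2 * t - 1 - 2 * x + (q * (2 * t) + x) = q * (2 * t) + (2 * t - 1 - x) + n.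
  by lia.
by rewrite modnDr modn_small; have := block_lt q3 x2; lia.
Qed.

Let cen_val (r : G) q x : q < 3 -> x < 2 * t -> r = q * (2 * t) + x :> nat ->
  cen r = q :> nat.
Proof. by move=> q3 x2 er; rewrite /cen er block_div // inordK. Qed.

Let handled i d : hd i d = None <-> ~~ H d.
Proof.
rewrite /hd; split.
  case: pickP => // no _; apply/negP => /andP[od lt_d].
  have lt_dn := ltn_ord d.
  (* The solution of 2t - 1 - 2x = d modulo n, an integer because d is odd and n is even. *)
  pose x := if d < 2 * t then (2 * t - 1 - d)./2 else (n + 2 * t - 1 - d)./2.
  have x2 : x < 2 * t by rewrite /x; case: ifP lt_d => /= _ lt_d; lia.
  have ltr : i * (2 * t) + x < n := lt6 (block_lt (ltn_ord i) x2).
  have /negP[] := negbT (no (inord (i * (2 * t) + x))).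
  have er : (inord (i * (2 * t) + x) : G) = i * (2 * t) + x :> nat by rewrite inordK.
  apply/and3P; split.
  - by apply/eqP/stem_small; rewrite er block_lt.
  - by apply/eqP/ord_inj; rewrite (cen_val _ x2 er).
  - apply/eqP/ord_inj; rewrite (dl_val _ x2 er) // /x; move: lt_d; clear no x x2 ltr er.
    by case: (ltnP d (2 * t)) => /= ? ?; case: ifP => ?; lia.
move=> nH; case: pickP => // r /and3P[/eqP/stem_small lt_r _ /eqP ed].
have [q [x [q3 x2 er _]]] := blockP lt_r.
move: nH; rewrite /H -ed (dl_val q3 x2 er); case: ltnP => xt; clear er ed q3 lt_r; lia.
Qed.

Let add_dl (r : G) : (r + dl r)%R = inord (mir r).
Proof. by rewrite /dl addrC subrK. Qed.

Let dlP r : stem r = None -> [/\ stem (r + dl r)%R = None,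
  cen (r + dl r)%R = cen r, dl (r + dl r)%R = (- dl r)%R & dl r != 0%R].
Proof.
move/stem_small=> lt_r; have [q [x [q3 x2 er [eq em]]]] := blockP lt_r.
have x2' : 2 * t - 1 - x < 2 * t by lia.
have ltm : mir r < n by rewrite em lt6 ?block_lt.
have er' : (r + dl r)%R = q * (2 * t) + (2 * t - 1 - x) :> nat.
  by rewrite add_dl inordK.
split.
- by apply/stem_small; rewrite er' block_lt.
- by apply: ord_inj; rewrite (cen_val q3 x2' er') (cen_val q3 x2 er).
- have -> : dl (r + dl r)%R = (inord (mir (r + dl r)%R) - (r + dl r))%R by [].
  have -> : inord (mir (r + dl r)%R) = r.
    apply: ord_inj; rewrite /mir er' block_div // modnMDl modn_small //.
    by rewrite er inordK; have := lt6 (block_lt q3 x2); lia.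
  by rewrite opprD addrA subrr add0r.
- apply/eqP=> /(congr1 (@nat_of_ord _)); rewrite (dl_val q3 x2 er) /=.
  by case: ifP => ? e0; clear er em eq ltm er'; lia.
Qed.

Let hdP i d r : hd i d = Some r <-> [/\ stem r = None, cen r = i & dl r = d].
Proof.
rewrite /hd; split.
  by case: pickP => // r' /and3P[/eqP sr /eqP cr /eqP dr] [<-].
case=> sr cr dr; case: pickP => [r' /and3P[/eqP sr' /eqP cr' /eqP dr']|/(_ r)].
  congr Some; apply: ord_inj.
  move/stem_small: sr => /blockP[q [x [q3 x2 er _]]].
  move/stem_small: sr' => /blockP[q' [x' [q3' x2' er' _]]].
  have eq : q = q' by rewrite -(cen_val q3 x2 er) -(cen_val q3' x2' er') cr cr'.
  have := congr1 (@nat_of_ord _) (etrans dr (esym dr')).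
  rewrite (dl_val q3 x2 er) (dl_val q3' x2' er') er er' eq => e1.
  have -> // : x = x'; clear -e1 x2 x2' nE; move: e1.
  by case: ifP => ?; case: ifP => ?; lia.
by rewrite sr cr dr !eqxx.
Qed.

Lemma nested_tripling : exists c : cpt 'I_3 'I_n 'I_s -> _, candelabra c.
Proof.
(* The first odd number beyond the differences in [H]; its negative also avoids them, as n is at
   least 6t. *)
pose e : G := inord (2 * t).+1.
have ee : e = (2 * t).+1 :> nat by rewrite inordK //; lia.
have HN d : H (- d)%R = H d.
  rewrite /H /=; have lt_d := ltn_ord d; case: (posnP d) => [->|d0].
    by rewrite subn0 modnn.
  rewrite modn_small; last by lia.
  have -> : odd (n - d) = odd d by lia.
  by rewrite subKn; [rewrite orbC|exact: ltnW].
have H_odd d : H d -> odd d by case/andP.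
have He : ~~ H e by rewrite /H ee; lia.
have od_e : odd e by rewrite ee; lia.
pose od (a : G) := odd a.
have odD a b : od (a + b)%R = od a (+) od b by apply: odd_Zp_add.
apply: (@tripling_candelabra _ _ ksum stem cen dl hd (parity_mate od e)) => //.
- by move=> i j d /handled nH; apply/handled.
- by move=> a a' b; apply: parity_mateC.
- by move=> a a' b; apply: parity_mateK.
move=> i a a' b aa' /handled nH.
have [m1 m2 m3] := @parity_mateP _ od e H odD od_e HN H_odd He a a' b aa' nH.
by split=> //; apply/handled.
Qed.

End NestedTripling.

(** * Small systems *)

Section Explicit.
Variable f : nat -> nat -> nat -> nat.

Definition sorted_app (x y z : nat) : nat :=
  let l := minn (minn x y) z in let h := maxn (maxn x y) z in
  f l (x + y + z - l - h) h.

Lemma sorted_app12 x y z : sorted_app x y z = sorted_app y x z.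
Proof. by rewrite /sorted_app [minn x y]minnC [maxn x y]maxnC [x + y]addnC. Qed.

Lemma sorted_app23 x y z : sorted_app x y z = sorted_app x z y.
Proof. by rewrite /sorted_app [minn _ z]minnAC [maxn _ z]maxnAC [x + y + z]addnAC. Qed.

Variables (N : nat) (ins : nat -> nat -> nat -> bool).
Hypothesis ins12 : forall x y z, ins x y z = ins y x z.
Hypothesis ins23 : forall x y z, ins x y z = ins x z y.

(** Only increasing triples are run through. The last three tests say that w together with any two
    of x, y, z gives back the third, which covers all triples of the block. *)
Definition explicit_check : bool :=
  all (fun z => all (fun y => all (fun x => ins x y z ||
    let w := f x y z in
    [&& w < N, w != x, w != y, w != z,
        ~~ ins x y w, ~~ ins x z w, ~~ ins y z w,
        sorted_app x y w == z, sorted_app x z w == y & sorted_app y z w == x])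
    (iota 0 y)) (iota 0 z)) (iota 0 N).

Lemma explicit_checkP x y z : explicit_check -> x < N -> y < N -> z < N ->
  x != y -> x != z -> y != z -> ~~ ins x y z ->
  let w := sorted_app x y z in
  [/\ w < N, w != x, w != y, ~~ ins x y w & sorted_app x y w = z].
Proof.
move=> chk; have C a b c : a < b -> b < c -> c < N -> ~~ ins a b c ->
  let w := f a b c in
  [/\ w < N, w != a, w != b & w != c] /\
  [/\ ~~ ins a b w, ~~ ins a c w & ~~ ins b c w] /\
  [/\ sorted_app a b w = c, sorted_app a c w = b & sorted_app b c w = a].
  move=> ab bc cN nI; have /allP/(_ c) := chk.
  rewrite mem_iota => /(_ cN) /allP/(_ b); rewrite mem_iota => /(_ bc) /allP/(_ a).
  rewrite mem_iota => /(_ ab); rewrite (negPf nI) /=.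
  by case/and5P=> ? ? ? ? /and5P[? ? ? /eqP? /andP[/eqP? /eqP?]].
have S a b c : a < b -> b < c -> sorted_app a b c = f a b c.
  by move=> ab bc; rewrite /sorted_app; congr f; lia.
wlog xy : x y / x < y => [IH|].
  move=> xN yN zN xy xz yz nI; case: (ltngtP x y) (xy) => // lt _.
    exact: (IH x y lt xN yN zN xy xz yz nI).
  rewrite eq_sym in xy; rewrite ins12 in nI.
  have /= [] := IH y x lt yN xN zN xy yz xz nI.
  by rewrite -(sorted_app12 x y z) ins12 [sorted_app y x _]sorted_app12; split.
move=> xN yN zN _ xz yz nI /=.
case: (ltngtP y z) yz => // [yz|zy] _.
  by rewrite S //; have [[? ? ? ?] [[? ? ?] [? ? ?]]] := C x y z xy yz zN nI.
case: (ltngtP x z) xz => // [xz|zx] _.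
  rewrite sorted_app23 S //; rewrite ins23 in nI.
  by have [[? ? ? ?] [[? ? ?] [? ? ?]]] := C x z y xz zy yN nI.
rewrite sorted_app23 sorted_app12 S //; rewrite ins23 ins12 in nI.
by have [[? ? ? ?] [[? ? ?] [? ? ?]]] := C z x y zx xy yN nI.
Qed.

End Explicit.

(* The points of [cpt 'I_3 'I_g 'I_s] are numbered group after group, the stem
   coming last with group number 3. *)
Definition grp_code (g x : nat) : nat := minn 3 (x %/ g).
Definition compat_code (i j : nat) : bool := [|| i == 3, j == 3 | i == j].
Definition inside_code (g x y z : nat) : bool :=
  let i := grp_code g x in let j := grp_code g y in let k := grp_code g z in
  [&& compat_code i j, compat_code i k & compat_code j k].

(* Transversals with sum 8 or 11 go to the stem; the sums {1, 2}, {5, 6} and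
   {9, 10} have the centres 0, 1 and 2.  There remain two pairs of sums, {0, 3}
   and {4, 7}, to be divided among three centres: the centre then depends on
   the residues mod 3, as p - q and as 1 - p + q. *)
Definition cqs12 (x y z : nat) : nat :=
  let sub a b := (a + 12 - b) %% 12 in
  let add a b := (a + b) %% 12 in
  let md a := a %% 3 in
  let ev a := if odd a then add a 7 else a in
  let mate a a' b :=
    let d := sub a' a in
    if (d == 3) || (d == 9) then
      let st := (if d == 3 then a else a') %/ 3 in
      if odd (b %/ 3 + st) then sub b 3 else add b 3
    else if (odd a == odd a') || (ev a == ev a') then
      let b' := sub (add (ev a) (ev a')) (ev b) in
      if b' == ev b then (if odd b then sub b 5 else add b 5)
      else (if odd b then add b' 5 else b')
    else let d := if odd a then sub a a' else sub a' a in
      if odd b then sub b d else add b d in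
  let cen r p q := nth 4 [:: md (p + 12 - q); 0; 0; md (p + 12 - q);
     md (1 + q + 12 - p); 1; 1; md (1 + q + 12 - p); 4; 2; 2; 4] r in
  let dl r := nth 0 [:: 3; 1; 11; 9; 3; 1; 11; 9; 0; 1; 11; 0] r in
  let i := x %/ 12 in let a := x %% 12 in
  let j := y %/ 12 in let b := y %% 12 in
  let k := z %/ 12 in let c := z %% 12 in
  let centre (i j a b c : nat) r :=
    let v := fun n => if n == i then a else if n == j then b else c in
    cen r (v 0) (v 1) in
  let pair i j a a' b :=
    let l := 3 - i - j in
    let d := sub a' a in
    let fits := fun r =>
      (dl r == d) && (centre i j a b (sub r (add a b)) r == i) in
    let rs := filter fits [:: 0; 1; 2; 3; 4; 5; 6; 7; 9; 10] in
    if rs is r :: _ then 12 * l + sub r (add a b) else 12 * j + mate a a' b in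
  if k == 3 then 12 * (3 - i - j) + sub (if c == 0 then 8 else 11) (add a b)
  else if i == j then pair i k a b c
  else if j == k then pair j i b c a
  else
    let r := add (add a b) c in
    if r == 8 then 36 else if r == 11 then 37
    else let n := cen r a b in
      let d := dl r in
      if n == 0 then add a d else if n == 1 then 12 + add b d else 24 + add c d.

Lemma cqs12_check : explicit_check cqs12 38 (inside_code 12).
Proof. by vm_compute. Qed.

Definition fourth (bs : seq (seq nat)) (x y z : nat) : nat :=
  head 0 [seq w <- head [::] [seq b <- bs | all (mem b) [:: x; y; z]]
         | w \notin [:: x; y; z]].

Definition develop (sigma : nat -> nat) m (bs : seq (seq nat)) : seq (seq nat) :=
  flatten [seq traject (map sigma) b m | b <- bs].

(** Three groups of size 3 with the stem point 9. Adding 1 inside all groups and rotating the groups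
    are automorphisms, and five base blocks suffice. *)
Definition cqs3 : nat -> nat -> nat -> nat :=
  fourth (develop (fun x => if x == 9 then 9 else (x + 3) %% 9) 3
    (develop (fun x => if x == 9 then 9 else x %/ 3 * 3 + (x + 1) %% 3) 3
      [:: [:: 0; 1; 3; 4]; [:: 0; 1; 5; 8]; [:: 0; 3; 6; 9]; [:: 0; 4; 8; 9];
          [:: 0; 5; 7; 9]])).

Lemma cqs3_check : explicit_check cqs3 10 (inside_code 3).
Proof. by vm_compute. Qed.

(* Two copies of Z/7; the system is invariant under x -> x + 1 on both. *)
Definition sqs14 : nat -> nat -> nat -> nat :=
  fourth (develop (fun x => x %/ 7 * 7 + (x + 1) %% 7) 7
    [:: [:: 0; 1; 2; 4]; [:: 0; 1; 5; 9]; [:: 0; 1; 7; 8]; [:: 0; 1; 10; 11];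
        [:: 0; 1; 12; 13]; [:: 0; 2; 7; 9]; [:: 0; 2; 8; 13]; [:: 0; 2; 10; 12];
        [:: 0; 3; 7; 10]; [:: 0; 3; 8; 12]; [:: 0; 3; 9; 13]; [:: 0; 8; 9; 11];
        [:: 7; 8; 9; 12]]).

Lemma sqs14_check : explicit_check sqs14 14 (fun _ _ _ => false).
Proof. by vm_compute. Qed.

Lemma explicit_steiner f m : explicit_check f m.+1 (fun _ _ _ => false) ->
  steiner_order m.+1.
Proof.
move=> chk; pose F := sorted_app f.
pose q (x y z : 'I_m.+1) : 'I_m.+1 :=
  if x == y then z else if x == z then y else if y == z then x else inord (F x y z).
have K (x y z : 'I_m.+1) : x != y -> x != z -> y != z -> let w := F x y z in
    [/\ w < m.+1, w != x, w != y & F x y w = z].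
  move=> xy xz yz; pose ins := fun _ _ _ : nat => false.
  have insC x1 y1 z1 x2 y2 z2 : ins x1 y1 z1 = ins x2 y2 z2 by [].
  by have [] := @explicit_checkP f m.+1 ins (fun _ _ _ => insC _ _ _ _ _ _)
    (fun _ _ _ => insC _ _ _ _ _ _) x y z chk (ltn_ord x) (ltn_ord y) (ltn_ord z)
    xy xz yz isT.
exists q; split=> [x y z|x y z|x y|x y z]; rewrite /q.
- rewrite [y == x]eq_sym; case: (eqVneq x y) => // xy.
  case: (eqVneq x z) => [exz|xz]; case: (eqVneq y z) => [eyz|yz] //.
    by rewrite exz eyz eqxx in xy.
  by rewrite /F sorted_app12.
- rewrite [z == y]eq_sym; case: (eqVneq x y) => [<-|xy]; case: (eqVneq x z) => //.
  by case: (eqVneq y z) => // yz xz; rewrite /F sorted_app23.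
- by rewrite eqxx.
- have [//|xy] := eqVneq x y; have [<-|xz] := eqVneq x z.
    by rewrite eqxx (negPf xy).
  have [<-|yz] := eqVneq y z; first by rewrite eqxx.
  have [wm wx wy wK] := K x y z xy xz yz.
  have -> : (x == inord (F x y z)) = false.
    by rewrite -val_eqE /= inordK // eq_sym (negPf wx).
  have -> : (y == inord (F x y z)) = false.
    by rewrite -val_eqE /= inordK // eq_sym (negPf wy).
  by apply: ord_inj; rewrite !inordK ?wK.
Qed.

Lemma explicit_candelabra f g s :
  explicit_check f (3 * g.+1 + s.+1) (inside_code g.+1) ->
  exists c : cpt 'I_3 'I_g.+1 'I_s.+1 -> _, candelabra c.
Proof.
move=> chk; pose P := cpt 'I_3 'I_g.+1 'I_s.+1; pose N := 3 * g.+1 + s.+1.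
pose code (x : P) : nat :=
  match x with inl p => p.1 * g.+1 + p.2 | inr r => 3 * g.+1 + r end.
pose decode (n : nat) : P :=
  if n < 3 * g.+1 then inl (inord (n %/ g.+1), inord (n %% g.+1))
  else inr (inord (n - 3 * g.+1)).
have codeN x : code x < N.
  case: x => [[i a]|r] /=; rewrite /N; last by rewrite ltn_add2l.
  have := ltn_ord i; have := ltn_ord a.
  by case: i => [[|[|[|//]]] ?] /=; lia.
have codeK : cancel code decode.
  case=> [[i a]|r] /=; rewrite /decode.
    have -> : i * g.+1 + a < 3 * g.+1.
      have := ltn_ord i; have := ltn_ord a.
      by case: i => [[|[|[|//]]] ?] /=; lia.
    by rewrite divnMDl // modnMDl divn_small // modn_small // addn0 !inord_val.
  by rewrite ltnNge leq_addr /= addKn inord_val.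
have decodeK n : n < N -> code (decode n) = n.
  rewrite /decode /N => ltn; case: ltnP => ltg /=.
    by rewrite !inordK ?ltn_pmod ?ltn_divLR // -divn_eq.
  by rewrite inordK ?subnKC //; lia.
have grpE (x : P) : grp_code g.+1 (code x) = if grp x is Some i then val i else 3.
  rewrite /grp_code; case: x => [[i a]|r] /=.
    by rewrite divnMDl // divn_small // addn0; case: i => [[|[|[|//]]] ?].
  apply/minn_idPl; rewrite leq_divRL //; lia.
have compE (x y : P) : compat_code (grp_code g.+1 (code x)) (grp_code g.+1 (code y))
    = compat (grp x) (grp y).
  rewrite !grpE /compat_code; case: (grp x) => [i|]; case: (grp y) => [j|] //=.
  - by rewrite -val_eqE; case: i j => [[|[|[|//]]] ?] [[|[|[|//]]] ?].
  - by rewrite orbT.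
have insE (x y z : P) : inside_code g.+1 (code x) (code y) (code z) = inside x y z.
  by rewrite /inside_code /= !compE.
have compC i j : compat_code i j = compat_code j i.
  by rewrite /compat_code orbCA [i == j]eq_sym.
have i12 x y z : inside_code g.+1 x y z = inside_code g.+1 y x z.
  by rewrite /inside_code /= compC [X in _ && X]andbC.
have i23 x y z : inside_code g.+1 x y z = inside_code g.+1 x z y.
  by rewrite /inside_code /= andbCA [compat_code (grp_code _ y) _]compC.
pose m (x y z : P) : P := decode (sorted_app f (code x) (code y) (code z)).
exists (distinct_op m); apply: distinct_candelabra.
- by move=> x y z _; rewrite /m sorted_app12.
- by move=> x y z _; rewrite /m sorted_app23.
move=> x y z; rewrite -insE => nI.
rewrite -!(can_eq codeK) => xy xz yz.
have [wN wx wy nIw wK] :=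
  explicit_checkP i12 i23 chk (codeN x) (codeN y) (codeN z) xy xz yz nI.
by rewrite /m decodeK //; split=> //; [rewrite -insE decodeK|rewrite wK codeK].
Qed.

(** * Existence of Steiner quadruple systems *)

Lemma steiner_order2 : steiner_order 2.
Proof.
rewrite -card_bool; apply: (@steiner_order_card _ (fun x y z => x (+) y (+) z)).
by split; do !case.
Qed.

(** The ordinary doubling is the lowest level of the tower, where the cyclic group has order 2. *)
Lemma steiner_order_double u : 0 < u -> ~~ odd u -> steiner_order u ->
  steiner_order (u * 2).
Proof.
move=> u_gt0 ev_u [q qS]; have eu : #|'I_u| = (u./2.-1).*2.+2 by rewrite card_ord; lia.
have [col [par fac]] := factoring_exists eu.
have [G [e [h [q' [cG _ _ qS' _]]]]] := cyclic_steiner_exists fac qS 0.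
by have := steiner_order_card qS'; rewrite card_prod card_ord cG.
Qed.

Lemma steiner_order_weight n (G : finZmodType) (S : finType)
    (c : cpt 'I_3 G S -> _) (q : G + S -> G + S -> G + S -> G + S) :
  steiner_order n.+1 -> candelabra c -> steiner_op q ->
  (forall s t r, exists r', q (inr s) (inr t) (inr r) = inr r') ->
  steiner_order (n * #|G| + #|S|).
Proof.
move=> On cC qS q_stem; have [|Q QS] := @steiner_on (option 'I_n) _ On.
  by rewrite card_option card_ord.
have := candelabra_steiner_order (weight_candelabra QS cC) qS q_stem.
by rewrite card_ord.
Qed.

(** Any block is closed under [q], hence can serve as a stem of size 4. *)
Lemma block_stem g : steiner_order (g.+1 + 4) ->
  exists2 q : 'I_g.+1 + 'I_4 -> 'I_g.+1 + 'I_4 -> 'I_g.+1 + 'I_4 -> 'I_g.+1 + 'I_4,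
    steiner_op q & forall s t r, exists r', q (inr s) (inr t) (inr r) = inr r'.
Proof.
case=> q qS; pose X := 'I_(g.+1 + 4).
(* Three distinct points, used only to obtain some block B. *)
pose o k : X := rshift g.+1 (inord k); pose B : {set X} := blk q (o 0) (o 1) (o 2).
have /andP[/eqP cB /forall_inP clB] : is_block q B.
  by apply: blk_block => //; rewrite (inj_eq (@rshift_inj _ _)) -val_eqE /= !inordK.
have cB' : #|~: B| = g.+1 by rewrite cardsCs setCK cB card_ord addnK.
pose f (x : 'I_g.+1 + 'I_4) : X :=
  match x with
  | inl i => enum_val (cast_ord (esym cB') i)
  | inr i => enum_val (cast_ord (esym cB) i)
  end.
have fB i : f (inr i) \in B by exact: enum_valP.
have fB' i : f (inl i) \notin B by rewrite -in_setC; exact: enum_valP.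
have f_inj : injective f.
  case=> [i|i] [j|j] ef.
  - by congr inl; apply: (@cast_ord_inj _ _ (esym cB')); apply: enum_val_inj.
  - by have := fB' i; rewrite ef fB.
  - by have := fB' j; rewrite -ef fB.
  - by congr inr; apply: (@cast_ord_inj _ _ (esym cB)); apply: enum_val_inj.
have [h fK hK] : bijective f.
  by apply: inj_card_bij => //; rewrite card_sum !card_ord.
exists (fun x y z => h (q (f x) (f y) (f z))).
  exact: (steiner_transport fK hK qS).
move=> s t r; case E: (h _) => [i|i]; last by exists i.
have := fB' i; rewrite -E hK.
by rewrite (forall_inP (forall_inP (clB _ (fB s)) _ (fB t)) _ (fB r)).
Qed.

Lemma steiner_order4 : steiner_order 4.
Proof. exact: (@steiner_order_double 2 isT isT steiner_order2). Qed.

Lemma steiner_order14 : steiner_order 14.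
Proof. exact: explicit_steiner sqs14_check. Qed.

Lemma steiner_order_3n1 n : steiner_order n.+1 -> steiner_order (n * 3 + 1).
Proof.
move=> On; have [c cC] := @explicit_candelabra cqs3 2 0 cqs3_check.
have [|q qS] := @steiner_on ('I_3 + 'I_1)%type 4 steiner_order4.
  by rewrite card_sum !card_ord.
have := @steiner_order_weight n _ _ c q On cC qS (small_stem_closed _ qS).
by rewrite !card_ord; apply.
Qed.

Lemma steiner_order_12n2 n : steiner_order n.+1 -> steiner_order (n * 12 + 2).
Proof.
move=> On; have [c cC] := @explicit_candelabra cqs12 11 1 cqs12_check.
have [|q qS] := @steiner_on ('I_12 + 'I_2)%type 14 steiner_order14.
  by rewrite card_sum !card_ord.
have := @steiner_order_weight n _ _ c q On cC qS (small_stem_closed _ qS).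
by rewrite !card_ord; apply.
Qed.

Lemma steiner_order_triple2 k t : 0 < t -> k.*2.+2 = 6 * t + 2 ->
  steiner_order (k.*2.+2 + 2) -> steiner_order (3 * k.*2.+2 + 2).
Proof.
move=> t0 ek Of; have [c cC] := nested_tripling ek t0.
have [|q qS] := @steiner_on ('I_(k.*2.+2) + 'I_2)%type _ Of.
  by rewrite card_sum !card_ord.
(* The system of order 4 has a single line, so here weighting only fills the three groups. *)
have := @steiner_order_weight 3 _ _ c q steiner_order4 cC qS (small_stem_closed _ qS).
by rewrite !card_ord; apply.
Qed.

Lemma steiner_order_triple4 k t : 0 < t -> k.*2.+2 = 6 * t + 4 ->
  steiner_order (k.*2.+2 + 4) -> steiner_order (3 * k.*2.+2 + 4).
Proof.
move=> t0 ek /block_stem[q qS q_stem]; have [c cC] := nested_tripling ek t0.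
have := @steiner_order_weight 3 _ _ c q steiner_order4 cC qS q_stem.
by rewrite !card_ord.
Qed.

Theorem steiner_order_all u : u %% 6 = 2 \/ u %% 6 = 4 -> steiner_order u.
Proof.
elim/ltn_ind: u => u IH u6.
have [u4|u4] := boolP (4 %| u).
  have -> : u = u %/ 2 * 2 by lia.
  by apply: steiner_order_double; try apply: IH; lia.
have [->|u2] := eqVneq u 2; first exact: steiner_order2.
(* Order 14 is a base case because f -> 12f - 10 fills its groups with systems of order 14. *)
have [->|u14] := eqVneq u 14; first exact: steiner_order14.
(* Now u is 2 modulo 4. The residues 14 and 22 modulo 24 are split modulo 72 because 3f - 2 and 12f
   - 10 would need an f divisible by 6 when u is 70, respectively 62, modulo 72; there 3f - 8 and 3f
   - 4 take over. *)
have : u %% 24 \in [:: 2; 10] \/ u %% 72 \in [:: 22; 46] \/ u %% 72 \in [:: 14; 38]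
    \/ u %% 72 = 62 \/ u %% 72 = 70 by rewrite !inE; lia.
rewrite !inE => -[h|[h|[h|[h|h]]]].
- pose k := (u %/ 8).-1; have -> : u = 4 * k.*2.+2 + 2 by rewrite /k; lia.
  by apply: steiner_order_quadruple; apply: IH; rewrite /k; lia.
- have -> : u = (u %/ 3) * 3 + 1 by lia.
  by apply: steiner_order_3n1; apply: IH; lia.
- have -> : u = (u %/ 12) * 12 + 2 by lia.
  by apply: steiner_order_12n2; apply: IH; lia.
- pose k := ((u - 2) %/ 6).-1; have -> : u = 3 * k.*2.+2 + 2 by rewrite /k; lia.
  apply: (@steiner_order_triple2 _ (k.*2 %/ 6)); rewrite /k; try lia.
  by apply: IH; lia.
- pose k := ((u - 4) %/ 6).-1; have -> : u = 3 * k.*2.+2 + 4 by rewrite /k; lia.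
  apply: (@steiner_order_triple4 _ ((k.*2 - 2) %/ 6)); rewrite /k; try lia.
  by apply: IH; lia.
Qed.

Theorem theorem9p4 (u n : nat) :
  (u %% 6 = 2 \/ u %% 6 = 4) -> 0 < n ->
  exists C : {set 'M[bool]_(u, 2 ^ n)},
    is_OOC2D 4 2 C /\ #|C| = Jstar u (2 ^ n).
Proof.
move=> u6; case: n => // n _; have [q qS] := steiner_order_all u6.
exact: OOC_of_steiner u6 qS.
Qed.
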